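(* For $n$ players and $2$ transmission channels with ternary feedback, there exists a unique anonymous, history-independent equilibrium protocol, and it has the following form: when $m$ players are pending, $2\le m\le n$, every pending player in every slot $t\ge1$ attempts transmission on each of the two channels with the same probability $p_m$. Moreover $p_m=\Theta(1/\sqrt{m})$, and this protocol yields to every player expected future latency $e^{\Theta(\sqrt{m})}$ when $m$ players are pending.
   Context: Contention game: $n$ players, channel set $K=\{1,\dots,k\}$ (here $k=2$), discrete slots $t=1,2,\dots$; each player has one packet and is initially pending. In each slot a pending player chooses (possibly at random) an action in $\{0,1,\dots,k\}$ ($0$ = no transmission, $a$ = transmit on channel $a$). A lone transmitter on a channel succeeds and leaves; two or more transmitters on a channel collide and remain pending. Latency $T_i$ = slot of player $i$'s successful transmission; players minimize expected latency. Expected future latency at slot $t$ = conditional expected latency minus $t$. Ternary feedback: in every slot every pending player is informed of the current number $m$ of pending players. A history-independent protocol is one whose decision rules depend only on the number $m$ of pending players (not on the player's transmission history or on time). Anonymous: all players use the same protocol, independent of identity. Equilibrium protocol: when all players use it, no player at any slot and after any history can decrease her conditional expected latency by unilaterally deviating. *)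

(* Defs.v *)
From HB Require Import structures.
From mathcomp Require Import all_boot all_order all_algebra.
From mathcomp Require Import all_classical all_reals all_analysis.
Set Implicit Arguments. Unset Strict Implicit. Unset Printing Implicit Defensive.
Import Order.TTheory GRing.Theory Num.Theory.
Local Open Scope ring_scope.

(* Contention game with k channels.  An action of a pending player is an
   element of 'I_k.+1 : 0 = no transmission, c > 0 = transmit on channel c. *)

Definition action (k : nat) := 'I_k.+1.

Definition is_dist (R : realType) (k : nat) (d : action k -> R) :=
  (forall a, 0 <= d a) /\ \sum_(a : action k) d a = 1.

(* A history-independent anonymous protocol: the (common) distribution of the
   action of every pending player depends only on the number m of pending
   players. *)
Definition protocol (R : realType) (k : nat) := nat -> action k -> R.

Definition valid_protocol (R : realType) (k n : nat) (q : protocol R k) :=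
  forall m, (1 <= m <= n)%N -> is_dist (q m).

(* One slot, seen from a tagged pending player, when m players (including her)
   are pending, she plays [a] and the m-1 other pending players play the
   profile [f]. *)
Definition chan_count (k m : nat) (f : {ffun 'I_m.-1 -> action k})
  (a c : action k) : nat := (#|[set i | f i == c]| + (a == c))%N.

Definition n_success (k m : nat) (f : {ffun 'I_m.-1 -> action k}) (a : action k) : nat :=
  #|[set c : action k | (c != ord0) && (chan_count f a c == 1%N)]|.

Definition tagged_success (k m : nat) (f : {ffun 'I_m.-1 -> action k}) (a : action k) : bool :=
  (a != ord0) && (#|[set i | f i == a]| == 0%N).

Definition profile_prob (R : realType) (k m : nat) (d : action k -> R)
  (f : {ffun 'I_m.-1 -> action k}) : R := \prod_i d (f i).

Definition trans (R : realType) (k : nat) (d : action k -> R) (m : nat)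
  (a : action k) (m' : nat) : R :=
  \sum_(f : {ffun 'I_m.-1 -> action k} |
          ~~ tagged_success f a && ((m - n_success f a)%N == m'))
     profile_prob d f.

(* Histories observed by the tagged player from the current slot on, in
   chronological order: her own action in each slot and the number of pending
   players announced afterwards (ternary feedback).  A general (possibly
   history-dependent, randomized) strategy maps such a history to a law. *)
Definition history (k : nat) := seq (action k * nat).
Definition strategy (R : realType) (k : nat) := history k -> action k -> R.

Definition valid_strategy (R : realType) (k : nat) (s : strategy R k) :=
  forall h, is_dist (s h).

Fixpoint surv (R : realType) (k : nat) (q : protocol R k) (t : nat)
  (s : strategy R k) (m : nat) {struct t} : R :=
  match t with
  | 0 => 1
  | t'.+1 =>
      \sum_(a : action k) s [::] a *
        \sum_(m' < m.+1) trans (q m) m a m' *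
           surv q t' (fun h => s ((a, nat_of_ord m') :: h)) m'
  end.

Definition prot_strat (R : realType) (k : nat) (q : protocol R k) (m : nat) : strategy R k :=
  fun h => q (last m (map snd h)).

(* conditional expected future latency (number of slots, counting the current
   one, until her successful transmission), possibly +oo *)
Definition latency (R : realType) (k : nat) (q : protocol R k) (s : strategy R k)
  (m : nat) : \bar R :=
  (\sum_(0 <= t <oo) (surv q t s m)%:E)%E.

(* Equilibrium: after any history (whatever the current number m of pending
   players, 1 <= m <= n), no unilateral deviation to any strategy decreases
   the conditional expected latency. *)
Definition equilibrium (R : realType) (k n : nat) (q : protocol R k) :=
  forall m, (1 <= m <= n)%N ->
    forall s : strategy R k, valid_strategy s ->
      (latency q (prot_strat q m) m <= latency q s m)%E.

Definition ch1 : action 2 := @Ordinal 3 1 isT.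
Definition ch2 : action 2 := @Ordinal 3 2 isT.

(* Main.v *)
Require Import Defs.
From HB Require Import structures.
From mathcomp Require Import all_boot all_order all_algebra.
From mathcomp Require Import all_classical all_reals all_analysis.
From mathcomp Require Import ring lra.
Import Order.TTheory GRing.Theory Num.Theory.
Set Implicit Arguments. Unset Strict Implicit. Unset Printing Implicit Defensive.
Local Open Scope ring_scope.

(** Let [W_m] be the equilibrium latency with [m] pending players, [N = m - 1], and let a pending
    player use the two channels with probabilities [x, y].  By one-shot deviations an equilibrium
    is exactly a solution of [W_m = 1 + min_a C_a], all actions in use being optimal, where the
    expected continuations [C_a] only involve [W_m, W_{m-1}, W_{m-2}] and multinomial
    probabilities.  If [x > y], the conditions [C_1 <= C_0] and [C_1 <= C_2] contradict a polynomial
    inequality, so [x = y = p].  In terms of the odds [u = p / (1 - p)] the remaining equations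
    compare [(1+u)^N] with [W_{m-1}] times a decreasing function of [u] (up to a correction that
    [(1+u)^N] outgrows), hence they have exactly one root.  At this root, with [s = N u],
    [ln W_{m-1} <= s <= 8 ln W_{m-1}] and [(W_m - W_{m-1}) / W_{m-1}] is of order [1 / s], so
    [(ln W_m)^2] grows linearly in [m], and [s] is of order [sqrt m]. *)

(** * Inequalities of one slot *)

(** Each stage is solved from crude facts on the two before it: [W_{m-1} >= 4] locates the root,
    [W_{m-1} <= 2^(m-3)] keeps it below [p = 1/2], and [2 (W_{m-1} - W_{m-2}) <= W_{m-1}] excludes a
    second root. They persist because the latency at most doubles from one stage to the next, but
    they hold only from [m = 5] on. For [m = 2, 3, 4] silence has probability zero, [p = 1/2], and
    the latencies [2, 8/3, 4] are computed explicitly. The asymmetry argument needs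
    [W_{m-1} <= W_m], which is not known in advance, so monotonicity gets its own proof, which
    cannot presuppose [x = y]. The horizon is infinite, yet one-shot deviations suffice: a strategy
    of finite latency has survival probabilities tending to zero. Equilibrium latencies are finite
    because some deviation has a geometrically bounded waiting time. *)

Section Powers.
Variable R : rcfType.
Implicit Types t v x y : R.

Lemma bernoulli_ge t k : 0 <= 1 + t -> 1 + k%:R * t <= (1 + t) ^+ k.
Proof.
move=> ht; elim: k => [|k IH]; first by rewrite expr0; lra.
have h1 : 1 + k.+1%:R * t <= (1 + t) * (1 + k%:R * t).
  rewrite -[k.+1%:R]natr1; have k0 : 0 <= k%:R :> R by [].
  have := sqr_ge0 t; rewrite expr2; nra.
rewrite exprS; apply: (le_trans h1); exact: ler_wpM2l.
Qed.

Lemma bernoulli2_ge t k : 0 <= t ->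
  1 + k%:R * t + k%:R * (k%:R - 1) / 2 * t ^+ 2 <= (1 + t) ^+ k.
Proof.
move=> ht; elim: k => [|k IH]; first by rewrite expr0; lra.
have k0 : 0 <= (k%:R : R) * (k%:R - 1).
  by case: k {IH} => [|k]; [rewrite mul0r | apply: mulr_ge0 => //; rewrite -natr1; have : 0 <= k%:R :> R by []; lra].
rewrite [_ ^+ k.+1]exprS; apply: (@le_trans _ _ ((1 + t) * (1 + k%:R * t + k%:R * (k%:R - 1) / 2 * t ^+ 2))); last first.
  by apply: ler_wpM2l => //; lra.
rewrite -[k.+1%:R]natr1.
have t3 : 0 <= t ^+ 3 by exact: exprn_ge0.
rewrite -subr_ge0.
have -> : (1 + t) * (1 + k%:R * t + k%:R * (k%:R - 1) / 2 * t ^+ 2) -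
  (1 + (k%:R + 1) * t + (k%:R + 1) * (k%:R + 1 - 1) / 2 * t ^+ 2) =
  k%:R * (k%:R - 1) / 2 * t ^+ 3 by field.
by apply: mulr_ge0 => //; lra.
Qed.

(** AM-GM for two copies of [k v / 2] and [k] copies of [1 - v], whose sum is [k], together with
    [(1 + 2/k)^k >= 4]. For [k = 1] the left side reaches [4/3], which is why the smallest number of
    opponents is treated apart in several places below. *)
Lemma sqr_pow_le1 v k : (2 <= k)%N -> 0 <= v <= 1 ->
  (k.+2%:R * v) ^+ 2 * (1 - v) ^+ k <= 1.
Proof.
move=> k2 /andP[v0 v1].
have kR : (2 : R) <= k%:R by rewrite ler_nat.
pose F (i : 'I_(2 + k)) : R := if (i < 2)%N then k%:R * v / 2 else 1 - v.
have F0 i : 0 <= F i by rewrite /F; case: ifP => _; nra.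
have := (leif_AGM (A := predT) (E := F) (fun i _ => F0 i)).1.
rewrite cardT size_enum_ord.
have -> : \sum_(i in predT) F i = k%:R.
  rewrite big_split_ord /= !big_ord_recl big_ord0 /F /=.
  rewrite (eq_bigr (fun=> 1 - v)); last by move=> i _.
  by rewrite sumr_const card_ord -mulr_natr; lra.
have -> : \prod_(i in predT) F i = (k%:R * v / 2) ^+ 2 * (1 - v) ^+ k.
  rewrite big_split_ord /= !big_ord_recl big_ord0 /F /=.
  rewrite (eq_bigr (fun=> 1 - v)); last by move=> i _.
  by rewrite prodr_const card_ord mulr1 expr2.
rewrite add2n => agm.
set Z : R := k.+2%:R in agm *.
have ZE : Z = k%:R + 2 by rewrite /Z -addn2 natrD.
have Z0 : 0 < Z by rewrite ZE; lra.
have k0 : 0 < k%:R :> R by lra.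
have h4 : 4 <= (Z / k%:R) ^+ k.
  have -> : Z / k%:R = 1 + 2 / k%:R by rewrite ZE; field; lra.
  apply: le_trans (bernoulli2_ge _ _); last by apply: divr_ge0 => //; lra.
  have -> : 1 + k%:R * (2 / k%:R) + k%:R * (k%:R - 1) / 2 * (2 / k%:R) ^+ 2 =
    4 + (k%:R - 2) / k%:R :> R by field; lra.
  by rewrite lerDl divr_ge0 //; lra.
have h4' : 4 * (k%:R / Z) ^+ k <= 1.
  have e1 : (Z / k%:R) ^+ k * (k%:R / Z) ^+ k = 1.
    by rewrite -exprMn (_ : Z / k%:R * (k%:R / Z) = 1) ?expr1n //; field; lra.
  rewrite -[X in _ <= X]e1; apply: ler_wpM2r => //; apply: exprn_ge0; apply: divr_ge0; lra.
apply: le_trans h4'.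
have -> : (Z * v) ^+ 2 * (1 - v) ^+ k =
   (2 * Z / k%:R) ^+ 2 * ((k%:R * v / 2) ^+ 2 * (1 - v) ^+ k) by field; lra.
apply: (@le_trans _ _ ((2 * Z / k%:R) ^+ 2 * (k%:R / Z) ^+ k.+2)).
  by apply: ler_wpM2l => //; exact: sqr_ge0.
rewrite -[k.+2]addn2 [_ ^+ (k + 2)]exprD.
have -> : (2 * Z / k%:R) ^+ 2 * ((k%:R / Z) ^+ k * (k%:R / Z) ^+ 2) = 4 * (k%:R / Z) ^+ k.
  field; lra.
by [].
Qed.

(* [N v (1-v)^(N-2)] with [N = k+2]; substituting [t = v/(1-v)] makes it [N t / (1+t)^(k+1)]. *)
Lemma pow_bern v k (c : R) : 0 <= v <= 1 -> (1 <= k)%N -> 0 < c ->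
  (forall t, 0 <= t -> k.+2%:R * t < c * (1 + k.+1%:R * t + k.+1%:R * k%:R / 2 * t ^+ 2)) ->
  k.+2%:R * v * (1 - v) ^+ k < c.
Proof.
move=> /andP[v0 v1] k1 c0 H.
have [->|vn] := eqVneq v 1.
  by rewrite subrr expr0n; case: k k1 {H} => //= k _; rewrite mulr0.
have w0 : 0 < 1 - v by lra.
set t := v / (1 - v); have t0 : 0 <= t by apply: divr_ge0; lra.
have t1 : 1 + t = (1 - v)^-1 by rewrite /t; field; lra.
have := bernoulli2_ge k.+1 t0; rewrite t1.
have -> : k.+1%:R * (k.+1%:R - 1) = k.+1%:R * k%:R :> R by rewrite -[k.+1%:R]natr1; ring.
move=> B; have := lt_le_trans (H t t0) (ler_wpM2l (ltW c0) B) => {}H.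
have -> : k.+2%:R * v * (1 - v) ^+ k = k.+2%:R * t * (1 - v) ^+ k.+1.
  by rewrite /t exprS; field; lra.
have -> : c = c * (1 - v)^-1 ^+ k.+1 * (1 - v) ^+ k.+1.
  by rewrite -mulrA -exprMn mulVf ?expr1n ?mulr1 //; lra.
by rewrite ltr_pM2r // exprn_gt0.
Qed.

Lemma pow_lt1 v k : (1 <= k)%N -> 0 <= v <= 1 -> k.+2%:R * v * (1 - v) ^+ k < 1.
Proof.
move=> k1 hv; apply: pow_bern => // t t0; rewrite -[k.+2%:R]natr1 -[k.+1%:R]natr1.
have kR : (1 : R) <= k%:R by rewrite ler1n.
have h : t ^+ 2 <= (k%:R + 1) * k%:R / 2 * t ^+ 2.
  apply: ler_peMl; [exact: sqr_ge0 | nra].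
suff : t < 1 + t ^+ 2 by nra.
by have := sqr_ge0 (t - 1/2); rewrite !expr2; nra.
Qed.

Lemma pow_le23 v k : (2 <= k)%N -> 0 <= v <= 1 -> k.+2%:R * v * (1 - v) ^+ k <= 2 / 3.
Proof.
have c0 : 0 < 2 / 3 :> R by lra.
move=> k2 hv; apply/ltW; apply: (pow_bern hv (ltnW k2) c0) => t t0.
rewrite -[k.+2%:R]natr1 -[k.+1%:R]natr1.
have kR : (2 : R) <= k%:R by rewrite ler_nat.
set K : R := k%:R in kR *.
have : 0 <= 9 * K * t ^+ 2 by apply: mulr_ge0; [lra|exact: sqr_ge0].
have := sqr_ge0 (K * t - 2).
have := sqr_ge0 t; rewrite !expr2; nra.
Qed.

End Powers.

(** * Exclusion of unequal channel probabilities *)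

Section Asymmetry.
Variable R : rcfType.

Lemma geom_sum_mul (r : R) n : (1 - r) * (\sum_(i < n) r ^+ i) = 1 - r ^+ n.
Proof. by rewrite -opprB mulNr -subrX1 opprB. Qed.

Lemma geom_sum_bounds (r : R) n : 0 <= r <= 1 ->
  1 <= \sum_(i < n.+1) r ^+ i <= n.+1%:R.
Proof.
move=> /andP[r0 r1]; apply/andP; split.
  rewrite big_ord_recl expr0 lerDl sumr_ge0 // => i _; exact: exprn_ge0.
rewrite -[X in _ <= X%:R]card_ord -sumr_const; apply: ler_sum => i _.
exact: exprn_ile1.
Qed.

(** Let [N = k + 3] and let [S] be the geometric sum. Since [(1 - r) S = 1 - r^N], the first product
    splits into a part free of [S] and a multiple of [S (N r v - 1)]. If [N r v <= 1] the latter is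
    dropped and [pow_lt1] suffices; otherwise [S <= N] leaves [(N v)^2 (1 - v)^(N-2) r] plus a
    nonpositive term. *)
Lemma asymmetry_poly k (v r : R) : 0 <= v <= 1 -> 0 < r < 1 ->
  v * (1 - v) ^+ k.+1 * (k.+2%:R - k.+3%:R * r * (1 - v)) * (\sum_(i < k.+3) r ^+ i)
   + r ^+ k.+3 * (1 - v) ^+ k.+2 < 1 + v * r.
Proof.
move=> /andP[v0 v1] /andP[r0 r1].
have rR : 0 <= r <= 1 by lra.
have [S1 SN] := andP (geom_sum_bounds k.+2 rR).
have SE := geom_sum_mul r k.+3.
set S := \sum_(i < _) _ in S1 SN SE *.
have rk : 0 <= r ^+ k.+3 < 1.
  by rewrite exprn_ge0 ?(ltW r0) //= exprn_ilt1 // ltW.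
have wk : 0 <= (1 - v) ^+ k.+1 <= 1 by rewrite exprn_ge0 ?exprn_ile1 //=; lra.
have vr : 0 <= v * r by apply: mulr_ge0; lra.
have -> : v * (1 - v) ^+ k.+1 * (k.+2%:R - k.+3%:R * r * (1 - v)) * S =
  k.+3%:R * v * (1 - v) ^+ k.+1 * (1 - r ^+ k.+3) + v * (1 - v) ^+ k.+1 * S * (k.+3%:R * r * v - 1).
  rewrite -SE -[k.+3%:R]natr1; ring.
have vI : 0 <= v <= 1 by lra.
have P1 := pow_lt1 (isT : (1 <= k.+1)%N) vI.
set N : R := k.+3%:R in P1 SN *.
have N3 : 3 <= N by rewrite /N ler_nat.
have a0 : 0 <= N * v * (1 - v) ^+ k.+1.
  by apply: mulr_ge0; [nra|lra].
have b0 : 0 <= v * (1 - v) ^+ k.+1 by apply: mulr_ge0; lra.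
have [le1|gt1] := lerP (N * r * v) 1.
  have h1 : v * (1 - v) ^+ k.+1 * S * (N * r * v - 1) <= 0.
    by apply: mulr_ge0_le0; [apply: mulr_ge0 => //; lra | lra].
  have h2 : r ^+ k.+3 * (1 - v) ^+ k.+2 <= r ^+ k.+3.
    by apply: ler_piMr; [lra | apply: exprn_ile1; lra].
  nra.
have h1 : v * (1 - v) ^+ k.+1 * S * (N * r * v - 1) <= v * (1 - v) ^+ k.+1 * N * (N * r * v - 1).
  by apply: ler_wpM2r; [lra | apply: ler_wpM2l].
apply: (@le_lt_trans _ _ (N * v * (1 - v) ^+ k.+1 * (1 - r ^+ k.+3) +
   v * (1 - v) ^+ k.+1 * N * (N * r * v - 1) + r ^+ k.+3 * (1 - v) ^+ k.+2)).
  by rewrite lerD2r lerD2l.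
have -> : N * v * (1 - v) ^+ k.+1 * (1 - r ^+ k.+3) +
   v * (1 - v) ^+ k.+1 * N * (N * r * v - 1) + r ^+ k.+3 * (1 - v) ^+ k.+2 =
   (N * v) ^+ 2 * (1 - v) ^+ k.+1 * r + r ^+ k.+3 * (1 - v) ^+ k.+1 * (1 - v - N * v).
  by rewrite [_ ^+ k.+2]exprS; ring.
have h2 : r ^+ k.+3 * (1 - v) ^+ k.+1 * (1 - v - N * v) <= 0.
  apply: mulr_ge0_le0; first by apply: mulr_ge0; lra.
  by have : N * r * v <= N * v; nra.
suff : (N * v) ^+ 2 * (1 - v) ^+ k.+1 * r < 1 + v * r by lra.
have [k0|k0] := posnP k; last first.
  have := @sqr_pow_le1 _ v k.+1 k0 vI; rewrite -/N; nra.
(* Three opponents, outside the range of [sqr_pow_le1]. The double root [3/5] approximates the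
   maximizer of the left side, about [0.6055]. *)
have : 9 * v ^+ 2 * (1 - v) - v < 1.
  rewrite -subr_gt0.
  have -> : 1 - (9 * v ^+ 2 * (1 - v) - v) =
    9 * (v + 1/5) * (v - 3/5) ^+ 2 + (44/125 - 2/25 * v) by field.
  apply: ltr_wpDl; last lra.
  by apply: mulr_ge0; [lra | exact: sqr_ge0].
have -> : N = 3 by rewrite /N k0.
rewrite k0 expr1; nra.
Qed.

(* [gain0 = W_m - C_0] and [gain1 = W_m - C_1] for [N = m - 1] opponents, where [V = W_m],
   [D = W_m - W_{m-1}], [E = W_{m-1} - W_{m-2}], and [x, y] are the probabilities of the channel
   chosen by the player and of the other one. *)
Definition gain0 N (D E x y : R) :=
  N%:R * x * (1 - x) ^+ N.-1 * D + N%:R * y * (1 - y) ^+ N.-1 * D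
  - N%:R * N.-1%:R * x * y * (1 - x - y) ^+ N.-2 * (D - E).

Definition gain1 N (V D x y : R) :=
  (1 - x) ^+ N * V + N%:R * y * ((1 - y) ^+ N.-1 - (1 - x - y) ^+ N.-1) * D.

(* With [r = (1 - x) / (1 - y)] and [v = y / (1 - x)], eliminating [V] between the three
   conditions leaves exactly the negation of [asymmetry_poly]. *)
Lemma no_asymmetry N (V D E x y : R) : (2 <= N)%N -> 0 <= y -> y < x -> x + y <= 1 ->
  0 < V -> 0 <= D -> 0 <= E ->
  gain0 N D E x y <= 1 -> gain1 N V D x y = 1 -> gain1 N V D y x <= 1 -> False.
Proof.
move=> N2 y0 yx xy V0 D0 E0; rewrite /gain0 /gain1.
have -> : 1 - y - x = 1 - x - y by ring.
move=> g0 g1 g2.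
have x1 : x < 1.
  rewrite lt_neqAle; apply/andP; split; last lra.
  apply/eqP => xE; move: g1; have -> : y = 0 by lra.
  rewrite xE subrr expr0n; case: N N2 {g0 g2} => //= N _; rewrite !(mul0r, mulr0) addr0 => /eqP.
  by rewrite eq_sym oner_eq0.
have ab : (1 - x) ^+ N < (1 - y) ^+ N.
  by rewrite ltrXn2r; [|lra|lra]; case: N N2 {g0 g1 g2} => // N _; rewrite /=; lra.
have [De0|Dn0] := eqVneq D 0.
  move: g1 g2; rewrite De0 !mulr0 !addr0 => g1 g2; nra.
have {Dn0 D0} D0 : 0 < D by rewrite lt_neqAle eq_sym Dn0.
case: N N2 g0 g1 g2 ab => // -[] // [|k] _ /= g0 g1 g2 ab.
  move: g0 g1 g2 ab; rewrite !expr1 !expr2; nra.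
set z := 1 - x - y in g0 g1 g2 *.
have z0 : 0 <= z by rewrite /z; lra.
set N : R := k.+3%:R in g0 g1 g2 *; set N1 : R := k.+2%:R in g0 *.
have N0 : 0 < N by rewrite /N ltr0n.
have P0 : 0 <= N * N1 * x * y * z ^+ k.+1 * E.
  by rewrite !mulr_ge0 ?exprn_ge0 ?ler0n //; lra.
pose a := 1 - x; pose b := 1 - y; pose r := a / b; pose v := y / a.
have a0 : 0 < a by rewrite /a; lra.
have b0 : 0 < b by rewrite /b; lra.
have rI : 0 < r < 1.
  by rewrite divr_gt0 //= ltr_pdivrMr // mul1r /a /b; lra.
have vI : 0 <= v <= 1.
  by rewrite divr_ge0 ?(ltW a0) //= ler_pdivrMr // mul1r /a; lra.
have aE : a = r * b by rewrite /r; field; lra.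
have yE : y = v * r * b by rewrite -mulrA -aE /v; field; lra.
have xE : x = 1 - r * b by rewrite -aE /a; lra.
have bE : b * (1 + v * r) = 1 by rewrite mulrDr mulr1 [b * _]mulrC -yE /b; lra.
have zE : z = r * b * (1 - v).
  by rewrite mulrBr mulr1 -aE /z /v /a; field; rewrite -/a; lra.
clearbody v r; have [r0 r1] := andP rI; have [v0 v1] := andP vI.
have L3 := asymmetry_poly k vI rI.
have SE := geom_sum_mul r k.+3.
set S := \sum_(i < _) _ in L3 SE; rewrite -/N -/N1 in L3.
set M := x * a ^+ k.+2 + y * z ^+ k.+2 - N1 * x * y * z ^+ k.+1.
(* Silence is no better than the preferred channel; [hC] says the same of the other channel. *)
have hA : N * D * M <= a ^+ k.+3 * V by rewrite /M /a; lra.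
have hC : (b ^+ k.+3 - a ^+ k.+3) * V +
   N * D * (x * a ^+ k.+2 - y * b ^+ k.+2 - (x - y) * z ^+ k.+2) <= 0 by rewrite /a /b; lra.
(* With weights [1 - r^N] for [hA] and [r^N] for [hC], the terms in [V] cancel because
   [r = a / b]. *)
have hM : M * (1 - r ^+ k.+3) + r ^+ k.+3 *
   (x * a ^+ k.+2 - y * b ^+ k.+2 - (x - y) * z ^+ k.+2) <= 0.
  rewrite -(pmulr_rle0 _ (mulr_gt0 N0 D0)) mulrDr.
  have e : r ^+ k.+3 * (b ^+ k.+3 - a ^+ k.+3) = (1 - r ^+ k.+3) * a ^+ k.+3.
    by rewrite aE exprMn; ring.
  have q1 : 0 <= 1 - r ^+ k.+3 by rewrite subr_ge0 exprn_ile1 // ltW.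
  have q3 : 0 <= r ^+ k.+3 by rewrite exprn_ge0 // ltW.
  have hA' := ler_wpM2l q1 hA; have hC' := mulr_ge0_le0 q3 hC.
  by rewrite mulrDr mulrA e in hC'; clear -hA' hC'; lra.
suff : 0 < M * (1 - r ^+ k.+3) + r ^+ k.+3 *
   (x * a ^+ k.+2 - y * b ^+ k.+2 - (x - y) * z ^+ k.+2) by rewrite ltNge hM.
have -> : M * (1 - r ^+ k.+3) + r ^+ k.+3 *
   (x * a ^+ k.+2 - y * b ^+ k.+2 - (x - y) * z ^+ k.+2) =
  r ^+ k.+2 * b ^+ k.+3 * (1 - r) * ((1 + v * r) - (v * (1 - v) ^+ k.+1 * (N1 - N * r * (1 - v)) * S +
        r ^+ k.+3 * (1 - v) ^+ k.+2)).
  transitivity (r ^+ k.+2 * b ^+ k.+3 * ((1 - r) * (1 + v * r - r ^+ k.+3 * (1 - v) ^+ k.+2) -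
      v * (1 - v) ^+ k.+1 * (N1 - N * r * (1 - v)) * ((1 - r) * S))); last by ring.
  rewrite SE.
  have -> : N = N1 + 1 by rewrite /N /N1 natr1.
  rewrite /M xE yE zE aE !exprMn ![_ ^+ k.+3]exprS ![_ ^+ k.+2]exprS.
  set pr := r ^+ k.+1; set pb := b ^+ k.+1; set pw := (1 - v) ^+ k.+1.
  have vr0 : 1 + v * r != 0 by rewrite lt0r_neq0 // ltr_pwDl // mulr_ge0 // ltW.
  have {}bE : b = (1 + v * r)^-1 by apply: (mulIf vr0); rewrite bE mulVf.
  by clear -bE vr0; rewrite bE; field.
rewrite mulr_gt0 //; last by rewrite subr_gt0.
apply: mulr_gt0; last by rewrite subr_gt0.
by apply: mulr_gt0; exact: exprn_gt0.
Qed.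

End Asymmetry.

(** * Equilibrium conditions of one stage, and monotonicity of the latency *)

Section Stage.
Variable R : rcfType.

(* [V = 1 + min_a C_a] with every action in use optimal; here [U = W_{m-1}]. *)
Record stage N (U E V x y : R) : Prop := Stage {
  stage_gt0 : 0 < V;
  stage_x : 0 <= x;
  stage_y : 0 <= y;
  stage_xy : x + y <= 1;
  stage_le0 : gain0 N (V - U) E x y <= 1;
  stage_eq0 : x + y < 1 -> gain0 N (V - U) E x y = 1;
  stage_le1 : gain1 N V (V - U) x y <= 1;
  stage_eq1 : 0 < x -> gain1 N V (V - U) x y = 1;
  stage_le2 : gain1 N V (V - U) y x <= 1;
  stage_eq2 : 0 < y -> gain1 N V (V - U) y x = 1 }.

Lemma gain0_sym N (D E x y : R) : gain0 N D E x y = gain0 N D E y x.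
Proof. by rewrite /gain0 (_ : 1 - y - x = 1 - x - y); ring. Qed.

Lemma stage_sym N (U E V x y : R) : stage N U E V x y -> stage N U E V y x.
Proof.
by case=> ? ? ? xy g0 g0' ? ? ? ?; split => //; rewrite 1?[y + x]addrC // gain0_sym.
Qed.

Lemma binom_ge_lin n (a b : R) : 0 <= a -> 0 <= b ->
  n%:R * b * a ^+ n.-1 <= (a + b) ^+ n.
Proof.
move=> a0 b0; suff : a ^+ n + n%:R * b * a ^+ n.-1 <= (a + b) ^+ n.
  by have := exprn_ge0 n a0; lra.
elim: n => [|n IH]; first by rewrite !expr0 !mul0r addr0.
rewrite [_ ^+ n.+1 in leRHS]exprS; apply: le_trans (ler_wpM2l (addr_ge0 a0 b0) IH).
case: n {IH} => [|n] /=; first by rewrite !expr0 expr1 !mul0r; lra.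
rewrite -[n.+2%:R]natr1 ![_ ^+ n.+2]exprS [_ ^+ n.+1]exprS.
have : 0 <= n.+1%:R * b ^+ 2 * a ^+ n by rewrite !mulr_ge0 ?exprn_ge0.
have : 0 <= a ^+ n by rewrite exprn_ge0.
set p := a ^+ n; set k : R := n.+1%:R; rewrite expr2; lra.
Qed.

(** Replacing the factor [y] by [x] and dividing by [(1 - y)^N] leaves a bound in the conditional
    probability [w = x / (1 - y)] alone: [N (N-1) w^2 (1 - w)^(N-2) <= 1]. It is false for two
    opponents, whence the extra condition on [E] for [N = 2] in [stage_mono]. *)
Lemma pair_prob_le N (x y : R) : (3 <= N)%N -> 0 <= y -> y <= x -> x + y < 1 ->
  N%:R * N.-1%:R * x * y * (1 - x - y) ^+ N.-2 <= (1 - y) ^+ N.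
Proof.
case: N => // -[] // [] // k _ /= y0 yx xy.
have b0 : 0 < 1 - y by lra.
pose w := x / (1 - y).
have wI : 0 <= w <= 1 by rewrite divr_ge0 ?ler_pdivrMr ?mul1r //; lra.
have xE : x = w * (1 - y) by rewrite /w; field; lra.
have zE : 1 - x - y = (1 - w) * (1 - y) by rewrite mulrBl mul1r -xE; ring.
clearbody w.
have K : k.+3%:R * k.+2%:R * w ^+ 2 * (1 - w) ^+ k.+1 <= 1.
  case: k => [|k].
    rewrite expr1; have -> : 3 * 2 * w ^+ 2 * (1 - w) = 1 - (6 * (w + 1/3) * (w - 2/3) ^+ 2 + 1/9) by field.
    have : 0 <= (w + 1/3) * (w - 2/3) ^+ 2 by apply: mulr_ge0; [lra | exact: sqr_ge0].
    lra.
  apply: le_trans (@sqr_pow_le1 R w k.+2 isT wI).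
  rewrite exprMn; apply: ler_wpM2r; first by apply: exprn_ge0; lra.
  by apply: ler_wpM2r; [exact: sqr_ge0 | rewrite expr2 ler_wpM2l // ler_nat].
apply: (@le_trans _ _ (k.+3%:R * k.+2%:R * x * x * (1 - x - y) ^+ k.+1)).
  apply: ler_wpM2r; first by apply: exprn_ge0; lra.
  by apply: ler_wpM2l => //; rewrite !mulr_ge0 //; lra.
rewrite zE [in leLHS]xE exprMn; set b := 1 - y in b0 *.
have -> : k.+3%:R * k.+2%:R * (w * b) * (w * b) * ((1 - w) ^+ k.+1 * b ^+ k.+1) =
  k.+3%:R * k.+2%:R * w ^+ 2 * (1 - w) ^+ k.+1 * b ^+ k.+3.
  by rewrite ![b ^+ k.+3]exprS [b ^+ k.+2]exprS; ring.
by apply: ler_piMl => //; apply/exprn_ge0/ltW.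
Qed.

(* If [V < U], indifference to staying silent forces [U - V < E] and
   [(1 - y)^N V <= P E] with [P] the probability that both channels carry exactly one opponent;
   but [P <= (1 - y)^N], so [V <= E <= U - E < V]. *)
Lemma stage_mono N (U E V x y : R) : (1 <= N)%N -> stage N U E V x y ->
  0 <= E -> E <= U - E -> U <= 2 ^+ N -> (N = 2%N -> E <= 1) -> U <= V.
Proof.
move=> N1; wlog yx : x y / y <= x.
  by move=> H S; have [/H|/ltW/H] := lerP y x; apply => //; exact: stage_sym.
case=> V0 x0 y0 xy g0 g0e g1 g1e g2 g2e E0 ET UN EN2.
rewrite leNgt; apply/negP => VU.
set D := V - U in g0 g0e g1 g1e g2 g2e; have D0 : D < 0 by rewrite /D; lra.
have N0 : 0 < (N%:R : R) by rewrite ltr0n.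
have xp : 0 < x.
  rewrite lt_neqAle x0 andbT; apply/eqP => xE.
  have yE : y = 0 by lra.
  move: g0e; rewrite -xE yE /gain0 !(mulr0, mul0r) !addr0 subrr => /(_ ltr01) /eqP.
  by rewrite eq_sym oner_eq0.
have {g1e} g1e := g1e xp.
have h1 : 0 <= N%:R * y * ((1 - y) ^+ N.-1 - (1 - x - y) ^+ N.-1).
  apply: mulr_ge0; first exact: mulr_ge0.
  by rewrite subr_ge0 lerXn2r // ?nnegrE; lra.
(* If silence has probability zero, then [x >= 1/2] and [gain1 <= (1 - x)^N V < 2^-N U <= 1],
   against [gain1 = 1]. *)
have [xy1|xy1] := ltrP (x + y) 1; last first.
  have : (1 - x) ^+ N * V < 1.
    apply: (@lt_le_trans _ _ ((1 / 2) ^+ N * 2 ^+ N)); last first.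
      by rewrite -exprMn (_ : 1 / 2 * 2 = 1 :> R) ?expr1n //; field.
    apply: (@le_lt_trans _ _ ((1 / 2) ^+ N * V)).
      by apply: ler_wpM2r; [lra | rewrite lerXn2r // ?nnegrE; lra].
    by rewrite ltr_pM2l ?exprn_gt0 //; lra.
  move: g1e; rewrite /gain1; nra.
have {}g0e := g0e xy1.
have [yE|yn0] := eqVneq y 0.
  move: g0e; rewrite /gain0 yE !(mulr0, mul0r) subr0 addr0.
  have : 0 <= N%:R * x * (1 - x) ^+ N.-1 by rewrite !mulr_ge0 ?exprn_ge0 //; lra.
  nra.
have yp : 0 < y by rewrite lt_neqAle eq_sym yn0.
have {}g2e := g2e yp.
pose P := N%:R * N.-1%:R * x * y * (1 - x - y) ^+ N.-2.
have P0 : 0 <= P by rewrite /P !mulr_ge0 ?exprn_ge0 //; lra.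
have hA : P <= N%:R * x * (1 - x) ^+ N.-1.
  have := @binom_ge_lin N.-1 (1 - x - y) y _ y0; rewrite subrK => /(_ _)/wrap[]; first lra.
  by move=> /(ler_wpM2l (mulr_ge0 (ltW N0) x0)); rewrite /P; lra.
have hB : P <= N%:R * y * (1 - y) ^+ N.-1.
  have := @binom_ge_lin N.-1 (1 - y - x) x _ x0; rewrite subrK => /(_ _)/wrap[]; first lra.
  rewrite (_ : 1 - y - x = 1 - x - y); last by ring.
  by move=> /(ler_wpM2l (mulr_ge0 (ltW N0) y0)); rewrite /P; lra.
move: g0e g2e; rewrite /gain0 /gain1 -/P (_ : 1 - y - x = 1 - x - y); last by ring.
set A := _ * (1 - x) ^+ _ in hA *; set B := _ * (1 - y) ^+ _ in hB * => g0e g2e.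
have hz : 0 <= N%:R * x * (1 - x - y) ^+ N.-1 by rewrite !mulr_ge0 ?exprn_ge0 //; lra.
have h2 : (1 - y) ^+ N * V <= P * E by rewrite /A in g0e; nra.
have h3 : P * (- D) < P * E by nra.
have PE1 : 1 <= P * E by nra.
have Ppos : 0 < P by rewrite lt_neqAle P0 andbT; apply/eqP => PE; move: PE1; rewrite -PE mul0r; lra.
have {}h3 : - D < E by rewrite -(ltr_pM2l Ppos).
have Epos : 0 < E by lra.
have EV : E < V by rewrite /D in h3; lra.
have hb : 0 < (1 - y) ^+ N by rewrite exprn_gt0; lra.
have h4 : (1 - y) ^+ N < P by rewrite -(ltr_pM2r Epos); apply: lt_le_trans h2; rewrite ltr_pM2l.
case: (leqP 3 N) => [N3|].
  by have := pair_prob_le N3 y0 yx xy1; rewrite -/P; lra.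
(* For [N = 1] the pair probability [P] vanishes; for [N = 2] it is [2 x y <= 1/2], so [E <= 1]
   contradicts [1 <= P E]. *)
case: N N1 @P EN2 PE1 {hA hB A B h1 h2 h3 hz g0 g1 g2 g0e g2e g1e N0 UN P0 Ppos hb h4} => // -[_ P _|[|//] _ P /(_ erefl)] /=.
  by rewrite /P /= mulr0 !mul0r ler10.
have xy4 : x * y <= 1 / 4 by have := sqr_ge0 (x - y); rewrite expr2; nra.
have -> : P = 2 * (x * y) by rewrite /P /= expr0; ring.
by move=> E1; have : 0 <= x * y by [rewrite mulr_ge0]; nra.
Qed.

End Stage.

(** * Symmetric equilibria *)

Section ExpBounds.
Variable R : realType.
Implicit Types (u : R).

Lemma expR1_le : expR 1 <= 14 / 5 :> R.
Proof.
have h : (19 / 20) ^+ 20 <= expR (- 1) :> R.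
  have -> : (-1 : R) = 20%:R * - (1 / 20) by field.
  rewrite expRM_natl; apply: lerXn2r; rewrite ?nnegrE ?expR_ge0 //.
  by have := expR_ge1Dx (- (1 / 20) : R); lra.
have h5 : (5 / 14 : R) <= (19 / 20) ^+ 20.
  have -> : (19 / 20 : R) ^+ 20 = ((19 / 20) ^+ 5) ^+ 4 by rewrite -exprM.
  apply: (@le_trans _ _ ((7737 / 10000) ^+ 4)); first by rewrite !exprS expr0; lra.
  by apply: lerXn2r; rewrite ?nnegrE; rewrite ?exprS ?expr0; lra.
have e0 := expR_gt0 (1 : R).
have e1 : expR (-1) * expR 1 = 1 :> R by rewrite -expRD addNr expR0.
nra.
Qed.

(** A rational certificate for [exp s <= c]: raise to the power [b] and use [e <= 14/5]. *)
Lemma expR_ratio_le (a b : nat) (c s : R) : 0 < c -> (0 < b)%N -> s <= a%:R / b%:R ->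
  (14 / 5) ^+ a <= c ^+ b -> expR s <= c.
Proof.
move=> c0 b0 sab H.
rewrite -(@ler_pXn2r _ b) ?nnegrE ?expR_ge0 ?(ltW c0) //.
rewrite -expRM_natl; apply: le_trans H.
apply: (@le_trans _ _ (expR 1 ^+ a)); last first.
  by apply: lerXn2r; rewrite ?nnegrE ?expR_ge0 ?expR1_le //; lra.
rewrite -expRM_natl ler_expR mulr1 mulrC.
by rewrite -ler_pdivlMr // ltr0n.
Qed.

Lemma pow_le_expR u k : 0 <= u -> (1 + u) ^+ k <= expR (k%:R * u).
Proof.
move=> u0; rewrite expRM_natl; apply: lerXn2r.
- by rewrite nnegrE; lra.
- by rewrite nnegrE expR_ge0.
exact: expR_ge1Dx.
Qed.

End ExpBounds.

(** * The symmetric stage in terms of the odds *)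

Section DiagonalStage.
Variable R : realType.
Implicit Types (u p U V E D : R).

(* For [N = k + 2] and [p = u / (1 + u)], multiplying by [(1 + u)^N] turns [gain1] into
   [U + (V - U) dS] and [gain0] into [(V - U) (nS + dS) + E bS]. *)
Definition tauS k u : R := k.+2%:R * u * (1 - u) ^+ k.
Definition nS k u : R := (k.+2%:R * u - 1) * (1 - tauS k u).
Definition dS k u : R := 1 + k.+2%:R * u - tauS k u * (1 - u).
Definition bS k u : R := tauS k u * (k.+1%:R * u).

Lemma gain1_diag k p U V : 0 < p <= 1 / 2 ->
  gain1 k.+2 V (V - U) p p =
  (1 - p) ^+ k.+2 * (U + (V - U) * dS k (p / (1 - p))).
Proof.
move=> hp; set u := p / (1 - p).
have q0 : 0 < 1 - p by lra.
have pE : p = u * (1 - p) by rewrite /u; field; lra.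
have zE : 1 - p - p = (1 - u) * (1 - p) by rewrite mulrBl -pE; ring.
rewrite /gain1 zE /dS /tauS exprMn.
set q := 1 - p in q0 pE zE *; clearbody u q; rewrite /= pE ![_ ^+ k.+2]exprS ![_ ^+ k.+1]exprS.
by set x := (1 - u) ^+ k; set y := q ^+ k; ring.
Qed.

(** [nS] is chosen so that subtracting the scaled [gain1] removes [dS]: equal gains of silence and
    transmission read [(V - U) nS + E bS = U]. *)
Lemma gain0_diag k p D E : 0 < p <= 1 / 2 ->
  gain0 k.+2 D E p p =
  (1 - p) ^+ k.+2 * (D * (nS k (p / (1 - p)) + dS k (p / (1 - p))) + bS k (p / (1 - p)) * E).
Proof.
move=> hp; set u := p / (1 - p).
have q0 : 0 < 1 - p by lra.
have pE : p = u * (1 - p) by rewrite /u; field; lra.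
have zE : 1 - p - p = (1 - u) * (1 - p) by rewrite mulrBl -pE; ring.
rewrite /gain0 zE /nS /bS /dS /tauS /= exprMn.
have -> : k.+2%:R = k.+1%:R + 1 :> R by rewrite natr1.
set K : R := k.+1%:R.
set q := 1 - p in q0 pE zE *; clearbody u q; rewrite !pE ![_ ^+ k.+2]exprS ![_ ^+ k.+1]exprS.
by set x := (1 - u) ^+ k; set y := q ^+ k; ring.
Qed.

Lemma odds_pow p n : p < 1 -> (1 - p) ^+ n * (1 + p / (1 - p)) ^+ n = 1.
Proof.
move=> p1; rewrite -exprMn (_ : (1 - p) * (1 + p / (1 - p)) = 1) ?expr1n //.
by field; lra.
Qed.

Lemma tauS_ge0 k u : 0 <= u <= 1 -> 0 <= tauS k u.
Proof. by move=> hu; rewrite /tauS !mulr_ge0 ?exprn_ge0 //; lra. Qed.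

Lemma dS_ge1 k u : 0 <= u <= 1 -> 1 <= dS k u.
Proof.
move=> hu; have -> : dS k u = 1 + k.+2%:R * u * (1 - (1 - u) ^+ k.+1).
  by rewrite /dS /tauS exprS; ring.
rewrite lerDl mulr_ge0 //; first by rewrite mulr_ge0 //; lra.
by rewrite subr_ge0 exprn_ile1; lra.
Qed.

(** Put [s = (k+2) u] and [q = 1 + s + s^2/2]. The second-order Bernoulli bound at [u / (1 - u)]
    gives [tauS <= s / q], and [(s - 1) (1 - s / q) >= 1] amounts to [s^2 (s - 2) >= 4], true from
    about [2.594] on; hence the threshold [13/5]. *)
Lemma nS_ge1 k u : (2 <= k)%N -> u <= 1 -> 13 / 5 <= k.+2%:R * u -> 1 <= nS k u.
Proof.
move=> k2 u1 hs; have kR : (2 : R) <= k%:R by rewrite ler_nat.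
rewrite /nS; have [->|un] := eqVneq u 1.
  rewrite /tauS subrr expr0n; case: k k2 kR {hs} => // k _ kR.
  by rewrite /= !mulr0 subr0 !mulr1 -[k.+3%:R]natr1 -[k.+2%:R]natr1; lra.
have s1 : 1 <= k.+2%:R * u by lra.
have kE : k.+2%:R = k%:R + 2 :> R by rewrite -addn2 natrD.
have u0 : 0 < u.
  rewrite ltNge; apply/negP => u0; have : k.+2%:R * u <= 0 by rewrite mulr_ge0_le0.
  lra.
pose v := u / (1 - u).
have v0 : 0 <= v by rewrite divr_ge0 //; lra.
have vE : v * (1 - u) = u by rewrite /v; field; lra.
have pv : (1 - u) ^+ k * (1 + v) ^+ k = 1 by apply: odds_pow; lra.
have B := bernoulli2_ge k v0.
rewrite /tauS; set s := k.+2%:R * u in hs s1 *.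
have w0 : 0 < 1 - u by lra.
have h1 : s <= k%:R * v.
  rewrite -(ler_pM2r w0) -[k%:R * v * _]mulrA vE /s kE; rewrite /s kE in hs; nra.
have h2 : s ^+ 2 <= k%:R * (k%:R - 1) * v ^+ 2.
  rewrite -(ler_pM2r (mulr_gt0 w0 w0)).
  have -> : k%:R * (k%:R - 1) * v ^+ 2 * ((1 - u) * (1 - u)) = k%:R * (k%:R - 1) * u ^+ 2.
    by rewrite -[u in RHS]vE; ring.
  have -> : s ^+ 2 * ((1 - u) * (1 - u)) = (k.+2%:R * (1 - u)) ^+ 2 * u ^+ 2 by rewrite /s; ring.
  apply: ler_wpM2r; first exact: sqr_ge0.
  have c1 : 0 <= k.+2%:R * (1 - u) by rewrite mulr_ge0 //; lra.
  have c2 : k.+2%:R * (1 - u) <= k%:R - 3 / 5 by rewrite mulrBr mulr1 kE; rewrite /s kE in hs; lra.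
  rewrite expr2; nra.
have {B} B : 1 + s + s ^+ 2 / 2 <= (1 + v) ^+ k by apply: le_trans B; lra.
have wk : 0 < (1 - u) ^+ k by rewrite exprn_gt0.
have {B} : (1 - u) ^+ k * (1 + s + s ^+ 2 / 2) <= 1 by rewrite -[X in _ <= X]pv ler_pM2l.
set w := _ ^+ k => B.
set q := 1 + s + s ^+ 2 / 2 in B.
have q0 : 0 < q by rewrite /q; have := sqr_ge0 s; lra.
rewrite -(ler_pM2r q0) mul1r.
have e1 : q * s <= (q - s * w * q) * s + s * s by have : s * w * q <= s by [rewrite -mulrA ler_piMr //; lra]; nra.
have : q - s <= (1 - s * w) * q by have : s * w * q <= s by [rewrite -mulrA ler_piMr //; lra]; lra.
have : q <= (s - 1) * (q - s) by rewrite /q expr2; nra.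
by move=> a1 a2; apply: le_trans a1 _; rewrite -mulrA; apply: ler_wpM2l => //; lra.
Qed.

(** The line comes from [latency_at_most_doubles]: with [s = (k+2) u], the bounds [D > U >= 4] and
    [dS >= 1/3 + s] would give [(1+u)^(k+2) > 4 (4/3 + s)]. On each of four intervals [exp s] is
    bounded by a constant that does not exceed the line at the left end. *)
Lemma odds_pow_small k u : 0 <= u -> k.+2%:R * u <= 13 / 5 ->
  (1 + u) ^+ k.+2 <= 16 / 3 + 4 * (k.+2%:R * u).
Proof.
move=> u0 hs; apply: le_trans (pow_le_expR _ u0) _.
set s := _ * u in hs *; have s0 : 0 <= s by rewrite /s mulr_ge0.
have step (a b : nat) (c : R) : (0 < b)%N -> 0 < c -> s <= a%:R / b%:R ->
  (14 / 5) ^+ a <= c ^+ b -> c <= 16 / 3 + 4 * s -> expR s <= 16 / 3 + 4 * s.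
  move=> b0 c0 h1 h2; apply: le_trans; exact: expR_ratio_le h1 h2.
have [h|h] := lerP s 1.
  by apply: (step 1%N 1%N 3) => //; rewrite ?expr1; lra.
have [h2|h2] := lerP s 2.
  by apply: (step 2%N 1%N 9) => //; rewrite ?exprS ?expr0; lra.
have [h3|h3] := lerP s (5/2).
  by apply: (step 5%N 2%N (40/3)) => //; rewrite ?exprS ?expr0; lra.
apply: (step 13%N 5%N (46/3)) => //; lra.
Qed.

(* [U < D] would give [nS < 1], hence [(k + 2) u < 13 / 5], and then [(1 + u)^(k+2)] is too small. *)
Lemma latency_at_most_doubles k u U E D : (2 <= k)%N -> 0 <= u <= 1 -> 4 <= U -> 0 <= E ->
  D * dS k u = (1 + u) ^+ k.+2 - U -> D * nS k u + bS k u * E = U -> D <= U.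
Proof.
move=> k2 hu U4 E0 hd hn; rewrite leNgt; apply/negP => DU.
have t0 := tauS_ge0 k hu; have d1 := dS_ge1 k hu.
have b0 : 0 <= bS k u by apply: mulr_ge0 => //; apply: mulr_ge0 => //; lra.
have bE := mulr_ge0 b0 E0.
have n1 : nS k u < 1.
  by rewrite ltNge; apply/negP => n1; have : D <= D * nS k u by [rewrite ler_peMr //; lra]; lra.
have hs : k.+2%:R * u < 13 / 5.
  by rewrite ltNge; apply/negP => hs; have := nS_ge1 k2 (proj2 (andP hu)) hs; lra.
have := odds_pow_small (proj1 (andP hu)) (ltW hs); have : tauS k u <= 2 / 3 by apply: pow_le23.
move=> t1.
have : 1 + k.+2%:R * u - 2 / 3 <= dS k u by rewrite /dS; nra.
set s := _ * u in hs *; set d := dS k u in hd d1 *; nra.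
Qed.

End DiagonalStage.

(** * Uniqueness of the symmetric root *)

Section RootMonotonicity.
Variable R : realType.
Implicit Types (u U D : R).

(** The maximizer of [tauS] is [1 / (k+1)], so roots lie where [tauS] decreases. To its left
    [(1 + u)^(k+2) <= exp (4/3) <= 3.95], while a root needs at least [U >= 4]. *)
Lemma root_gt k u U D : (2 <= k)%N -> 0 <= u <= 1 -> 4 <= U -> 0 <= D ->
  D * dS k u = (1 + u) ^+ k.+2 - U -> 1 <= k.+1%:R * u.
Proof.
move=> k2 hu U4 D0 hd; have [u0 u1] := andP hu; have d1 := dS_ge1 k hu.
have X4 : 4 <= (1 + u) ^+ k.+2 by have : 0 <= D * dS k u by [apply: mulr_ge0; lra]; lra.
have kR : (2 : R) <= k%:R by rewrite ler_nat.
rewrite leNgt; apply/negP; rewrite -natr1 => hlt.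
have hs : k.+2%:R * u <= 4 / 3.
  have -> : k.+2%:R = k%:R + 2 :> R by rewrite -addn2 natrD.
  have : (k%:R + 2) * 3 <= (k%:R + 1) * 4 :> R by lra.
  by move/(ler_wpM2r u0); lra.
have := pow_le_expR k.+2 u0.
suff : expR (k.+2%:R * u) <= 395 / 100 by lra.
apply: (@expR_ratio_le _ 4 3); [lra | by [] | lra |].
by rewrite !exprS !expr0; lra.
Qed.

Lemma tauS_decr k u1 u2 : 1 <= k.+1%:R * u1 -> 0 < u1 -> u1 <= u2 -> u2 <= 1 ->
  tauS k u2 <= tauS k u1.
Proof.
move=> hk u0 u12 u21; rewrite /tauS -!mulrA; apply: ler_wpM2l => //.
have [->|un] := eqVneq u2 1.
  case: k hk => [|k] hk; last by rewrite subrr expr0n /= mulr0 mulr_ge0 ?exprn_ge0 //; lra.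
  by rewrite !expr0; lra.
have r2 : 0 < 1 - u2 by lra.
have r1 : 0 < 1 - u1 by lra.
pose t := (u2 - u1) / (1 - u2).
have t0 : 0 <= t by rewrite divr_ge0; lra.
have tE : (1 + t) * (1 - u2) = 1 - u1 by rewrite /t; field; lra.
rewrite -tE exprMn mulrA; apply: ler_wpM2r; first by apply: exprn_ge0; lra.
have t1 : 0 <= 1 + t by lra.
apply: le_trans (ler_wpM2l (ltW u0) (bernoulli_ge k t1)).
rewrite -(ler_pM2r r2).
have -> : u1 * (1 + k%:R * t) * (1 - u2) = u1 * (1 - u2) + k%:R * u1 * (u2 - u1).
  by rewrite /t; field; lra.
rewrite -natr1 in hk; nra.
Qed.

(** So [nS / dS] increases. The difference of the cross products splits into two terms, nonnegative
    because [(k+2) u] increases and [tauS] decreases. *)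
Lemma growth_ratio_mono k u1 u2 : (2 <= k)%N -> 1 <= k.+1%:R * u1 -> 0 < u1 -> u1 <= u2 -> u2 <= 1 ->
  nS k u1 * dS k u2 <= nS k u2 * dS k u1.
Proof.
move=> k2 hk u0 u12 u21.
have t12 := tauS_decr hk u0 u12 u21.
have t1 : tauS k u1 <= 2 / 3 by apply: pow_le23 => //; lra.
have t2 : 0 <= tauS k u2 by apply: tauS_ge0; lra.
have kE : k.+2%:R = k.+1%:R + 1 :> R by rewrite natr1.
have kR : (3 : R) <= k.+1%:R by rewrite ler_nat.
rewrite /nS /dS; set a := tauS k u1 in t1 t12 *; set b := tauS k u2 in t12 t2 *.
rewrite kE; set K : R := k.+1%:R in hk kR *.
pose s1 := (K + 1) * u1; pose s2 := (K + 1) * u2.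
have s12 : s1 <= s2 by rewrite ler_wpM2l //; lra.
have s1g : 1 < s1 by rewrite /s1; lra.
rewrite -/s1 -/s2 -subr_ge0.
have -> : (s2 - 1) * (1 - b) * (1 + s1 - a * (1 - u1)) - (s1 - 1) * (1 - a) * (1 + s2 - b * (1 - u2)) =
  2 * (1 - a) * (1 - b) * (s2 - s1) + ((1 - b) * a * ((s2 - 1) * (s1 + u1)) - (1 - a) * b * ((s1 - 1) * (s2 + u2))).
  ring.
apply: addr_ge0; first by rewrite !mulr_ge0 //; lra.
have h1 : (s1 - 1) * (s2 + u2) <= (s2 - 1) * (s1 + u1).
  rewrite /s1 /s2; have : 0 <= (K + 2) * (u2 - u1) by apply: mulr_ge0; lra.
  lra.
have h2 : (1 - a) * b <= (1 - b) * a by lra.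
rewrite subr_ge0; apply: ler_pM => //; first by apply: mulr_ge0; lra.
by apply: mulr_ge0; lra.
Qed.

(** A mean value estimate by algebra: the factor [u^2] is frozen at [u1], as its growth only helps,
    and the difference of [k]-th powers is factored. *)
Lemma bS_drop k u1 u2 : (1 <= k)%N -> 0 < u1 -> u1 <= u2 -> u2 <= 1 ->
  bS k u1 - bS k u2 <= k%:R * (k.+2%:R * k.+1%:R * u1 ^+ 2 * (1 - u1) ^+ k.-1) * (u2 - u1).
Proof.
move=> k1 u0 u12 u21.
have bE u : bS k u = k.+2%:R * k.+1%:R * (u ^+ 2 * (1 - u) ^+ k) by rewrite /bS /tauS; ring.
rewrite !bE -mulrBr.
have -> : k%:R * (k.+2%:R * k.+1%:R * u1 ^+ 2 * (1 - u1) ^+ k.-1) * (u2 - u1) =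
  k.+2%:R * k.+1%:R * (u1 ^+ 2 * (k%:R * (u2 - u1) * (1 - u1) ^+ k.-1)) by ring.
apply: ler_wpM2l => //.
apply: (@le_trans _ _ (u1 ^+ 2 * ((1 - u1) ^+ k - (1 - u2) ^+ k))).
  rewrite mulrBr lerD2l lerN2; apply: ler_wpM2r; first by apply: exprn_ge0; lra.
  by rewrite lerXn2r // ?nnegrE; lra.
apply: ler_wpM2l; first exact: sqr_ge0.
rewrite subrXX.
have -> : 1 - u1 - (1 - u2) = u2 - u1 by ring.
rewrite [k%:R * _]mulrC -mulrA; apply: ler_wpM2l; first lra.
have -> : k%:R * (1 - u1) ^+ k.-1 = \sum_(i < k) (1 - u1) ^+ k.-1.
  by rewrite sumr_const card_ord mulr_natl.
apply: ler_sum => i _.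
have -> : (1 - u1) ^+ k.-1 = (1 - u1) ^+ (k.-1 - i) * (1 - u1) ^+ i.
  by rewrite -exprD subnK //; case: k i {k1 bE} => [[]//|k i]; rewrite -ltnS ltn_ord.
apply: ler_wpM2l; first by apply: exprn_ge0; lra.
by rewrite lerXn2r // ?nnegrE; lra.
Qed.

End RootMonotonicity.

Section RootUniqueness.
Variable R : realType.
Implicit Types (u U E : R).

(* A root satisfies [X - U = (U - b E) d / n]; since [d / n] decreases in [u], two roots can
   only coexist if [b] drops faster than [X = (1+u)^N] grows. *)
Lemma two_roots_gap (N K B u1 u2 U E X1 X2 b1 b2 d1 d2 n1 n2 D1 D2 : R) :
  0 < N -> 0 <= u1 -> u1 < u2 -> 0 < U -> 0 <= E -> 1 <= d1 -> 0 < n1 -> 0 < n2 ->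
  b2 * E <= U -> n1 * d2 <= n2 * d1 -> b1 - b2 <= K * B * (u2 - u1) ->
  X1 * (N * (u2 - u1)) <= (1 + u1) * (X2 - X1) ->
  D1 * d1 = X1 - U -> D1 * n1 + b1 * E = U ->
  D2 * d2 = X2 - U -> D2 * n2 + b2 * E = U ->
  (U - b1 * E) * N < (1 + u1) * K * B * E.
Proof.
move=> N0 u0 u12 U0 E0 dd1 n10 n20 b2le hmono hdrop hX hd1 hn1 hd2 hn2.
have D20 : 0 <= D2 by rewrite -(pmulr_lge0 _ n20); lra.
have e2 : (X2 - U) * n1 <= (U - b2 * E) * d1.
  have -> : X2 - U = D2 * d2 by rewrite hd2.
  have -> : U - b2 * E = D2 * n2 by rewrite -hn2 addrK.
  by have := ler_wpM2l D20 hmono; clear; lra.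
have e1 : (X1 - U) * n1 = (U - b1 * E) * d1 by rewrite -hd1 -{1}hn1; ring.
have e3 : (X2 - X1) * n1 <= K * B * (u2 - u1) * E * d1.
  have Ed : 0 <= E * d1 by rewrite mulr_ge0 // (le_trans ler01).
  by have := ler_wpM2r Ed hdrop; clear -e1 e2; lra.
have du0 : 0 < u2 - u1 by rewrite subr_gt0.
have cpos : 0 < (u2 - u1) * d1 by rewrite mulr_gt0 // (lt_le_trans ltr01).
rewrite -(ltr_pM2r cpos).
have u1p : 0 <= 1 + u1 by rewrite addr_ge0.
have h1 := ler_wpM2l u1p e3.
have h2 := ler_wpM2r (ltW n10) hX.
have h3 : 0 < U * n1 * (N * (u2 - u1)).
  by apply: mulr_gt0; apply: mulr_gt0.
have h4 : X1 * (N * (u2 - u1)) * n1 = (U * n1 + (U - b1 * E) * d1) * (N * (u2 - u1)).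
  by rewrite -e1; ring.
by clear -h1 h2 h3 h4; lra.
Qed.

(** The negation of what [two_roots_gap] concludes. Since [bS = (1 - u) B], it reduces to
    [E B (2 (k+1) - 2 u) <= (k+2) U], and [sqr_pow_le1] gives [(k+1) B <= k+2]. For [k = 2] the
    exponent [k - 1] is too small for that bound, and [3 E <= U] makes up for it. *)
Lemma drop_le_growth k u U E : (2 <= k)%N -> 0 <= u <= 1 -> 4 <= U -> 0 <= E ->
  2 * E <= U -> (k = 2%N -> 3 * E <= U) ->
  (1 + u) * k%:R * (k.+2%:R * k.+1%:R * u ^+ 2 * (1 - u) ^+ k.-1) * E
    <= (U - bS k u * E) * k.+2%:R.
Proof.
move=> k2 uI U4 E0 E2 E3; have [u0 u1] := andP uI.
set B := k.+2%:R * k.+1%:R * u ^+ 2 * (1 - u) ^+ k.-1.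
have B0 : 0 <= B by rewrite /B !mulr_ge0 ?exprn_ge0 // subr_ge0.
have -> : bS k u = (1 - u) * B.
  by rewrite /bS /tauS /B; case: (k) k2 => // k' _; rewrite /= exprS; ring.
have KR : (3 : R) <= k.+1%:R by rewrite ler_nat.
have NE : k.+2%:R = k.+1%:R + 1 :> R by rewrite natr1.
have kE : k%:R = k.+1%:R - 1 :> R by rewrite -natr1 addrK.
suff e5 : E * B * (2 * k.+1%:R - 2 * u) <= k.+2%:R * U.
  by move: e5; rewrite kE NE; clear; lra.
have [k3|k3] := eqVneq k 2%N.
  have {}E3 := E3 k3.
  rewrite /B k3 /= expr1.
  have h : 12 * u ^+ 2 * (1 - u) * (6 - 2 * u) <= 12.
    have a1 : 0 <= u ^+ 2 * u by rewrite mulr_ge0 ?sqr_ge0.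
    have a2 : 0 <= (u - 2/3) ^+ 2 * (u + 4/3) by rewrite mulr_ge0 ?sqr_ge0 //; lra.
    clear -a1 a2 uI; rewrite !expr2 in a1 a2 *; nra.
  by have := ler_wpM2l E0 h; clear -E3; lra.
have k4 : (2 <= k.-1)%N by case: (k) k2 k3 => [|[|[|k']]].
have := @sqr_pow_le1 R u _ k4 uI; have -> : k.-1.+2 = k.+1 by case: (k) k2.
move=> hs; have hB : B * k.+1%:R <= k.+2%:R.
  have -> : B * k.+1%:R = k.+2%:R * ((k.+1%:R * u) ^+ 2 * (1 - u) ^+ k.-1) by rewrite /B; ring.
  by rewrite -[leRHS]mulr1; apply: ler_wpM2l.
clearbody B.
have h6 : 0 <= E * B * u by rewrite !mulr_ge0.
have h7 := ler_wpM2l E0 hB.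
have N0 : 0 <= k.+2%:R :> R by [].
have h8 := ler_wpM2r N0 E2.
by clear -h6 h7 h8; lra.
Qed.

Lemma root_unique k U E D1 D2 u1 u2 : (2 <= k)%N -> 0 < u1 -> u1 < u2 -> u2 <= 1 ->
  4 <= U -> 0 <= E -> 2 * E <= U -> (k = 2%N -> 3 * E <= U) -> 0 <= D1 ->
  D1 * dS k u1 = (1 + u1) ^+ k.+2 - U -> D1 * nS k u1 + bS k u1 * E = U ->
  D2 * dS k u2 = (1 + u2) ^+ k.+2 - U -> D2 * nS k u2 + bS k u2 * E = U -> False.
Proof.
move=> k2 u0 u12 u21 U4 E0 E2 E3 D10 hd1 hn1 hd2 hn2.
have I1 : 0 <= u1 <= 1 by lra.
have I2 : 0 <= u2 <= 1 by lra.
have hk1 := root_gt k2 I1 U4 D10 hd1.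
have hmono := growth_ratio_mono k2 hk1 u0 (ltW u12) u21.
have kE : k.+2%:R = k.+1%:R + 1 :> R by rewrite natr1.
have kR : (3 : R) <= k.+1%:R by rewrite ler_nat.
have hk2 : 1 <= k.+1%:R * u2 by nra.
have npos u : 0 <= u <= 1 -> 0 < u -> 1 <= k.+1%:R * u -> 0 < nS k u.
  move=> hu up hk; rewrite /nS; apply: mulr_gt0; first by rewrite kE; lra.
  by have : tauS k u <= 2 / 3 by [apply: pow_le23]; lra.
have n1 := npos _ I1 u0 hk1; have n2 := npos _ I2 (lt_trans u0 u12) hk2.
have dd1 := dS_ge1 k I1; have dd2 := dS_ge1 k I2.
have b2 : 0 <= bS k u2 by rewrite /bS mulr_ge0 ?tauS_ge0 // mulr_ge0 //; lra.
have b2le : bS k u2 * E <= U.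
  have : bS k u2 <= 1.
    apply: le_trans (sqr_pow_le1 k2 I2); rewrite /bS /tauS.
    have -> : (k.+2%:R * u2) ^+ 2 * (1 - u2) ^+ k = k.+2%:R * u2 * (1 - u2) ^+ k * (k.+2%:R * u2) by ring.
    apply: ler_wpM2l; first exact: tauS_ge0.
    by apply: ler_wpM2r; [lra | rewrite ler_nat].
  by move/(ler_wpM2r E0); lra.
have hdrop := bS_drop (ltnW k2) u0 (ltW u12) u21.
set X1 := (1 + u1) ^+ _ in hd1; set X2 := (1 + u2) ^+ _ in hd2.
have hX : X1 * (k.+2%:R * (u2 - u1)) <= (1 + u1) * (X2 - X1).
  have t0 : 0 <= 1 + (u2 - u1) / (1 + u1) by rewrite addr_ge0 // divr_ge0; lra.
  have := bernoulli_ge k.+2 t0.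
  have X1p : 0 <= X1 by apply: exprn_ge0; lra.
  move=> /(ler_wpM2l X1p).
  have -> : X1 * (1 + (u2 - u1) / (1 + u1)) ^+ k.+2 = X2.
    by rewrite /X1 -exprMn; congr (_ ^+ _); field; lra.
  have u1p : 0 <= 1 + u1 by lra.
  move=> /(ler_wpM2l u1p).
  have -> : (1 + u1) * (X1 * (1 + k.+2%:R * ((u2 - u1) / (1 + u1)))) = (1 + u1) * X1 + X1 * (k.+2%:R * (u2 - u1)).
    by field; lra.
  lra.
have D1N : 0 < k.+2%:R :> R by [].
have := two_roots_gap D1N (ltW u0) u12 _ E0 dd1 n1 n2 b2le hmono hdrop hX hd1 hn1 hd2 hn2.
have U0 : 0 < U by lra.
by move=> /(_ U0); rewrite ltNge drop_le_growth.
Qed.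

End RootUniqueness.

Section RootExistence.
Variable R : realType.
Implicit Types (u U E : R).

(** The expression results from eliminating [D] from the two root equations. It is [-1] at [u = 0]
    and, because [U <= 2^k], positive at [u = 1]; the intermediate value theorem is applied to it as
    a polynomial. *)
Lemma root_exists k U E : (2 <= k)%N -> U <= 2 ^+ k -> 
  exists u, [/\ 0 < u < 1 &
   ((1 + u) ^+ k.+2 - U) * nS k u + (bS k u * E - U) * dS k u = 0].
Proof.
move=> k2 Uk.
pose tp : {poly R} := k.+2%:R *: 'X * (1%:P - 'X) ^+ k.
pose np := (k.+2%:R *: 'X - 1%:P) * (1%:P - tp).
pose dp := 1%:P + k.+2%:R *: 'X - tp * (1%:P - 'X).
pose bp := tp * (k.+1%:R *: 'X).
pose H := ((1%:P + 'X) ^+ k.+2 - U%:P) * np + (E *: bp - U%:P) * dp.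
have HE u : H.[u] = ((1 + u) ^+ k.+2 - U) * nS k u + (bS k u * E - U) * dS k u.
  rewrite /H /np /dp /bp /tp /bS /nS /dS /tauS.
  by rewrite !(horner_exp, hornerD, hornerN, hornerM, hornerZ, hornerX, hornerC); ring.
have H0 : H.[0] = -1.
  rewrite HE /nS /dS /bS /tauS !(mulr0, mul0r, addr0, subr0) expr1n; ring.
have H1 : 0 < H.[1].
  rewrite HE /nS /dS /bS /tauS subrr expr0n; case: (k) k2 Uk => // k' k2 Uk /=.
  rewrite !mulr0 !mulr1 !mul0r subr0 addrC.
  have -> : (1 + 1 : R) = 2 by ring.
  have -> : k'.+3%:R = k'.+1%:R + 2 :> R by rewrite -addn2 natrD.
  have kR : (2 : R) <= k'.+1%:R by rewrite ler_nat.
  have p0 : 0 < 2 ^+ k'.+1 :> R by rewrite exprn_gt0.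
  rewrite [2 ^+ _.+3]exprS [2 ^+ _.+2]exprS; set K : R := k'.+1%:R in kR *; set P := 2 ^+ _ in p0 Uk *.
  have : U * (K + 2) <= P * (K + 2) by apply: ler_wpM2r; lra.
  have : 0 < P * K by apply: mulr_gt0; lra.
  have : 2 * P <= P * K by rewrite mulrC ler_pM2l.
  lra.
have [||u /andP[u0 u1] /rootP Hu] := @poly_ivt _ H 0 1; [lra | by rewrite H0; lra |].
exists u; split; last by rewrite -HE.
rewrite !lt_neqAle u0 u1 !andbT; apply/andP; split; apply/eqP => ue.
  by move: Hu; rewrite -ue H0; lra.
by move: Hu H1; rewrite ue => ->; lra.
Qed.

End RootExistence.

(** * Diagonal form of a stage, and the stages with two to four players *)

Section SmallStages.
Variable R : realType.
Implicit Types (u U V E D : R).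

Lemma stage_gt0_x N U E V x y : (1 <= N)%N -> stage N U E V x y -> x = y -> 0 < x.
Proof.
move=> N1 S xy; rewrite lt_neqAle (stage_x S) andbT; apply/eqP => x0.
have := stage_eq0 S; rewrite -xy -x0 addr0 /gain0 !(mulr0, mul0r) subr0 addr0 => /(_ ltr01).
by move/eqP; rewrite eq_sym oner_eq0.
Qed.

Lemma stage_symmetric N U E V x y : (2 <= N)%N -> stage N U E V x y ->
  0 <= E -> U <= V -> x = y.
Proof.
move=> N2; wlog yx : x y / y <= x.
  move=> H S E0 UV; have [/H|/ltW/H] := lerP y x; first exact.
  by move=> /(_ (stage_sym S) E0 UV).
move=> S E0 UV; apply: le_anti; rewrite yx andbT leNgt; apply/negP => xy.
apply: (@no_asymmetry R N V (V - U) E x y N2 (stage_y S) xy (stage_xy S) (stage_gt0 S)) => //.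
- by rewrite subr_ge0.
- exact: stage_le0 S.
- by apply: (stage_eq1 S); exact: le_lt_trans (stage_y S) xy.
- exact: stage_le2 S.
Qed.

(** The last condition is only an inequality at [x = 1/2], where silence has probability zero and
    need not be optimal. *)
Lemma stage_diag k U E V x y : stage k.+2 U E V x y ->
  0 <= E -> E <= U - E -> U <= 2 ^+ k.+2 -> (k = 0%N -> E <= 1) ->
  let u := x / (1 - x) in
  [/\ y = x, 0 < x <= 1 / 2, U <= V, (V - U) * dS k u = (1 + u) ^+ k.+2 - U &
      (V - U) * nS k u + bS k u * E <= U /\
      (x < 1 / 2 -> (V - U) * nS k u + bS k u * E = U)].
Proof.
move=> S E0 ET UN EN u.
have UV : U <= V by apply: (stage_mono _ S) => // -[k0]; exact: EN.
have xy : x = y by exact: (stage_symmetric _ S).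
have x0 : 0 < x by exact: (stage_gt0_x _ S).
have hx : 0 < x <= 1 / 2 by have := stage_xy S; lra.
have pX := odds_pow k.+2 (_ : x < 1); rewrite -/u in pX.
have {}pX := pX ltac:(lra).
have q0 : 0 < (1 - x) ^+ k.+2 by rewrite exprn_gt0; lra.
have hd : (V - U) * dS k u = (1 + u) ^+ k.+2 - U.
  have := stage_eq1 S x0; rewrite -xy gain1_diag // -/u -[X in _ = X]pX => /(mulfI (lt0r_neq0 q0)); lra.
split => //; split.
  have := stage_le0 S; rewrite -xy gain0_diag // -/u -[X in _ <= X]pX ler_pM2l //; lra.
move=> x12; have := stage_eq0 S; rewrite -xy => /(_ ltac:(lra)).
rewrite gain0_diag // -/u -[X in _ = X]pX => /(mulfI (lt0r_neq0 q0)); lra.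
Qed.

Lemma stage_of_root k U E V x : 0 < x <= 1 / 2 -> 0 < V ->
  let u := x / (1 - x) in
  (V - U) * dS k u = (1 + u) ^+ k.+2 - U ->
  (V - U) * nS k u + bS k u * E <= U ->
  (x < 1 / 2 -> (V - U) * nS k u + bS k u * E = U) -> stage k.+2 U E V x x.
Proof.
move=> hx V0 u hd hn hn'.
have pX := odds_pow k.+2 (_ : x < 1); rewrite -/u in pX.
have {}pX := pX ltac:(lra).
have q0 : 0 < (1 - x) ^+ k.+2 by rewrite exprn_gt0; lra.
have g1 : gain1 k.+2 V (V - U) x x = 1.
  rewrite gain1_diag // -/u hd -[X in _ = X]pX; congr (_ * _); lra.
have g0 : gain0 k.+2 (V - U) E x x <= 1.
  rewrite gain0_diag // -/u -[X in _ <= X]pX ler_pM2l //; lra.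
split; rewrite ?g1 //; try lra.
move=> x12; rewrite gain0_diag // -/u -[X in _ = X]pX; congr (_ * _).
by have := hn' ltac:(lra); lra.
Qed.

Lemma stage1 E V x y : stage 1 1 E V x y -> [/\ V = 2, x = 1 / 2 & y = 1 / 2].
Proof.
case=> V0 x0 y0 xy; rewrite /gain0 /gain1 /= !expr0 !expr1 !mul1r !mulr1 subrr mulr0 !mul0r !addr0 subr0.
move=> g0 g0e g1 g1e g2 g2e.
have xp : 0 < x.
  rewrite lt_neqAle x0 andbT; apply/eqP => xE.
  have [yE|yp] := ltrP 0 y; first by have := g2e yE; rewrite -xE in g1 *; nra.
  have yE : y = 0 by lra.
  by move: g0e; rewrite -xE yE !mul0r addr0 => /(_ ltr01); lra.
have yp : 0 < y.
  rewrite lt_neqAle y0 andbT; apply/eqP => yE.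
  by have := g1e xp; rewrite -yE in g2 *; nra.
have e1 := g1e xp; have e2 := g2e yp.
have xyE : x = y by apply/eqP; rewrite -subr_eq0; apply/eqP/(mulIf (lt0r_neq0 V0)); lra.
move: g0e; rewrite -xyE => g0e.
have xE : x = 1 / 2.
  apply: le_anti; apply/andP; split; first lra.
  rewrite leNgt; apply/negP => x12; have := g0e ltac:(lra) => g.
  have : (2 * x - 1) * (x + 1) = 0 by nra.
  by nra.
have yE : y = 1 / 2 by rewrite -xyE.
by rewrite xE in e1; split => //; lra.
Qed.

Lemma stage1_exists E : stage 1 1 E 2 (1 / 2) (1 / 2 : R).
Proof.
by split; rewrite /gain0 /gain1 /= ?expr0 ?expr1 ?mul1r ?mulr1 ?subrr ?mulr0 ?mul0r; lra.
Qed.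

Lemma stage2 V x y : stage 2 2 1 V x y -> [/\ V = 8 / 3, x = 1 / 2 & y = 1 / 2].
Proof.
move=> S; have [] := stage_diag S; try (by rewrite ?exprS ?expr0; lra).
set u := x / (1 - x) => yx hx UV.
have uE : u * (1 - x) = x by rewrite /u; field; lra.
rewrite /dS /nS /bS /tauS expr0 mulr1 => hd [_ hn].
have xE : x = 1 / 2.
  apply: le_anti; apply/andP; split; first lra.
  rewrite leNgt; apply/negP => x12; have {}hn := hn x12.
  have u1 : u < 1 by nra.
  have u0 : 0 < u by nra.
  (* Here [nS = - (2 u - 1)^2], so indifference would force [2 u^2 >= 2], against [u < 1]. *)
  have : 0 <= (V - 2) * (2 * u - 1) ^+ 2 by rewrite mulr_ge0 ?sqr_ge0 //; lra.
  rewrite expr2; nra.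
split => //; last by rewrite yx.
have u1 : u = 1 by rewrite /u xE; field.
by move: hd; rewrite u1 !exprS expr0; lra.
Qed.

Lemma stage2_exists : stage 2 2 1 (8 / 3) (1 / 2) (1 / 2 : R).
Proof.
have u1 : (1 / 2) / (1 - 1 / 2) = 1 :> R by field.
apply: stage_of_root; rewrite ?u1 /dS /nS /bS /tauS ?exprS ?expr0; lra.
Qed.

Lemma stage3 V x y : stage 3 (8 / 3) (2 / 3) V x y -> [/\ V = 4, x = 1 / 2 & y = 1 / 2].
Proof.
move=> S; have [] := stage_diag S; try (by rewrite ?exprS ?expr0; lra).
set u := x / (1 - x) => yx hx UV.
have uE : u * (1 - x) = x by rewrite /u; field; lra.
rewrite /dS /nS /bS /tauS expr1 => hd [_ hn].
have xE : x = 1 / 2.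
  apply: le_anti; apply/andP; split; first lra.
  rewrite leNgt; apply/negP => x12; have {}hn := hn x12.
  have u1 : u < 1 by nra.
  have u0 : 0 < u by nra.
  pose D := V - 8 / 3; rewrite -/D in hd hn.
  (* eliminating [V] leaves a polynomial in [u] whose only root in [[0, 1]] is [1] *)
  have : (1 - u) * (1 + 14 * u - 9 * u ^+ 2 + 21 * u ^+ 3 + 21 * u ^+ 5) = 0.
    transitivity ((D * ((3 * u - 1) * (1 - 3 * u * (1 - u)))) * (1 + 3 * u - 3 * u * (1 - u) * (1 - u)) -
       (D * (1 + 3 * u - 3 * u * (1 - u) * (1 - u))) * ((3 * u - 1) * (1 - 3 * u * (1 - u)))); last by ring.
    have -> : D * ((3 * u - 1) * (1 - 3 * u * (1 - u))) = 8 / 3 - 3 * u * (1 - u) * (2 * u) * (2 / 3) by lra.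
    by rewrite hd; field.
  move/eqP; rewrite mulf_eq0 => /orP[/eqP|/eqP h]; first lra.
  have u3 : 0 <= u ^+ 3 by apply: exprn_ge0; lra.
  have u5 : 0 <= u ^+ 5 by apply: exprn_ge0; lra.
  have : u ^+ 2 <= u by rewrite expr2; nra.
  by clear hd hn; lra.
split => //; last by rewrite yx.
have u1 : u = 1 by rewrite /u xE; field.
by move: hd; rewrite u1 !exprS expr0; lra.
Qed.

Lemma stage3_exists : stage 3 (8 / 3) (2 / 3) 4 (1 / 2) (1 / 2 : R).
Proof.
have u1 : (1 / 2) / (1 - 1 / 2) = 1 :> R by field.
apply: stage_of_root; rewrite ?u1 /dS /nS /bS /tauS ?exprS ?expr0; lra.
Qed.

End SmallStages.

(** * The recursion over the number of players *)

Section EquilibriumSequence.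
Variable R : realType.
Implicit Types (u U V E D : R).

(** The invariant for [k + 3] players, with [U = W_{k+2}]. It starts at [k = 2], where [U = 4] and
    [E = 4/3] give equality in the first and the last two conditions. *)
Definition large k U E := [/\ 4 <= U, 0 <= E, 2 * E <= U, U <= 2 ^+ k & k = 2%N -> 3 * E <= U].

Lemma large_bounds k U E : (2 <= k)%N -> large k U E ->
  [/\ 0 <= E, E <= U - E, U <= 2 ^+ k.+2 & k = 0%N -> E <= 1].
Proof.
move=> k2 [U4 E0 E2 Uk _]; split => //; first lra; last by move=> k0; rewrite k0 in k2.
by apply: le_trans Uk _; rewrite ler_eXn2l ?ltr1n //; exact: leq_trans (leqnSn _) _.
Qed.

(** Excludes [p = 1/2], that is [u = 1]: there [dS = k + 3] and [nS = k + 1], and the opposite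
    inequality would follow from silence being no better than transmission. *)
Lemma end_positive k U : (2 <= k)%N -> U <= 2 ^+ k ->
  U * (k%:R + 3) < (2 ^+ k.+2 - U) * (k%:R + 1).
Proof.
move=> k2 Uk; have kR : (2 : R) <= k%:R by rewrite ler_nat.
rewrite ![2 ^+ _.+1]exprS; set P := 2 ^+ k in Uk *.
have P0 : 0 < P by rewrite exprn_gt0.
have k0 : 0 <= k%:R :> R by [].
have := ler_wpM2r k0 Uk; have := ler_wpM2l (ltW P0) kR; nra.
Qed.

Lemma stage_large k U E V x y : (2 <= k)%N -> large k U E -> stage k.+2 U E V x y ->
  let u := x / (1 - x) in
  [/\ y = x, 0 < x < 1 / 2, U <= V, (V - U) * dS k u = (1 + u) ^+ k.+2 - U &
      (V - U) * nS k u + bS k u * E = U].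
Proof.
move=> k2 L S u; have [E0 ET UN EN] := large_bounds k2 L.
have [yx hx UV hd [hn hn']] := stage_diag S E0 ET UN EN.
have [x12|x12] := ltrP x (1 / 2); first by split => //; [lra | exact: hn'].
have u1 : x / (1 - x) = 1 by have -> : x = 1 / 2 by [lra]; field.
have [_ _ _ Uk _] := L; have := end_positive k2 Uk.
move: hd hn; rewrite -/u in u1 *; rewrite u1 /dS /nS /bS /tauS subrr expr0n gtn_eqF ?(ltnW k2) //.
rewrite !mulr0 !mul0r !subr0 !addr0 !mulr1.
have -> : k.+2%:R = k%:R + 2 :> R by rewrite -addn2 natrD.
have -> : (1 + 1 : R) = 2 by ring.
have k0 : 0 <= k%:R :> R by [].
move=> hd hn; have e : (V - U) * (k%:R + 3) = 2 ^+ k.+2 - U by lra.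
rewrite -e; have : (V - U) * (k%:R + 1) * (k%:R + 3) <= U * (k%:R + 3) by apply: ler_wpM2r; lra.
by lra.
Qed.

Lemma odds_inj x1 x2 : x1 < 1 -> x2 < 1 -> x1 / (1 - x1) < x2 / (1 - x2) \/ x2 / (1 - x2) < x1 / (1 - x1) \/ x1 = x2 :> R.
Proof.
move=> h1 h2; have [|lt|] := ltgtP (x1 / (1 - x1)) (x2 / (1 - x2)); [by left | by right; left |].
move=> /(congr1 (fun t => t * (1 - x1) * (1 - x2))).
rewrite divfK; last lra.
by rewrite mulrAC divfK; [right; right; lra | lra].
Qed.

Lemma stage_large_unique k U E V1 V2 x1 x2 y1 y2 : (2 <= k)%N -> large k U E ->
  stage k.+2 U E V1 x1 y1 -> stage k.+2 U E V2 x2 y2 -> V1 = V2 /\ x1 = x2.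
Proof.
move=> k2 L S1 S2.
have [_ hx1 UV1 hd1 hn1] := stage_large k2 L S1.
have [_ hx2 UV2 hd2 hn2] := stage_large k2 L S2.
have uI (x : R) : 0 < x < 1 / 2 -> 0 < x / (1 - x) /\ x / (1 - x) <= 1.
  by move=> hx; rewrite divr_gt0 ?ler_pdivrMr //; lra.
have [u1p u1l] := uI _ hx1; have [u2p u2l] := uI _ hx2.
have [U4 E0 E2 _ E3] := L.
have D1 : 0 <= V1 - U by lra.
have D2 : 0 <= V2 - U by lra.
have [||lt|[lt|xE]] := @odds_inj x1 x2; [lra|lra| | |].
- by have := root_unique k2 u1p lt u2l U4 E0 E2 E3 D1 hd1 hn1 hd2 hn2.
- by have := root_unique k2 u2p lt u1l U4 E0 E2 E3 D2 hd2 hn2 hd1 hn1.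
split => //; rewrite -xE in hd2 u2p u2l.
have d1 : 1 <= dS k (x1 / (1 - x1)) by apply: dS_ge1; lra.
have d0 : dS k (x1 / (1 - x1)) != 0 by lra.
have : V1 - U = V2 - U by apply: (mulIf d0); rewrite hd1 hd2.
lra.
Qed.

Lemma stage_large_exists k U E : (2 <= k)%N -> large k U E ->
  exists V x, stage k.+2 U E V x x.
Proof.
move=> k2 L; have [U4 E0 E2 Uk E3] := L.
have [u [hu H]] := root_exists E k2 Uk.
have d1 : 1 <= dS k u by apply: dS_ge1; lra.
pose D := ((1 + u) ^+ k.+2 - U) / dS k u.
have hD : D * dS k u = (1 + u) ^+ k.+2 - U by rewrite /D divfK //; lra.
have X0 : 0 < (1 + u) ^+ k.+2 by rewrite exprn_gt0; lra.
have V0 : 0 < U + D.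
  rewrite -(pmulr_lgt0 _ (lt_le_trans ltr01 d1)) mulrDl hD.
  have : U <= U * dS k u by [rewrite ler_peMr //; lra]; lra.
have ue : (u / (1 + u)) / (1 - u / (1 + u)) = u by field; lra.
have UD : U + D - U = D by ring.
have hn : D * nS k u + bS k u * E = U.
  have d0 : dS k u != 0 by lra.
  by apply: (mulIf d0); rewrite mulrDl mulrAC hD; lra.
exists (U + D), (u / (1 + u)); apply: stage_of_root => //; rewrite ?ue ?UD ?hn //.
apply/andP; split; first by rewrite divr_gt0; lra.
by rewrite ler_pdivrMr; lra.
Qed.

(** Both upper bounds come from [V <= 2 U], which gives [V <= 2^(k+1)] and [2 (V - U) <= V]. *)
Lemma large_step k U E V x y : (2 <= k)%N -> large k U E -> stage k.+2 U E V x y ->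
  large k.+1 V (V - U).
Proof.
move=> k2 L S; have [U4 E0 E2 Uk E3] := L.
have [_ hx UV hd hn] := stage_large k2 L S.
have uI : 0 <= x / (1 - x) <= 1 by rewrite divr_ge0 ?ler_pdivrMr //; lra.
have DU := latency_at_most_doubles k2 uI U4 E0 hd hn.
split; [lra | lra | lra | by rewrite exprS; lra |].
by move=> [k1]; rewrite k1 in k2.
Qed.

(** For [N <= 3] the invariant [large] does not hold yet, so exact values are carried instead. *)
Definition admissible N U E :=
  match N with
  | 1 => U = 1
  | 2 => U = 2 /\ E = 1
  | 3 => U = 8 / 3 /\ E = 2 / 3
  | k.+2 => large k U E
  | _ => False
  end.

Lemma stage_unique N U E V1 V2 x1 x2 y1 y2 : admissible N U E ->
  stage N U E V1 x1 y1 -> stage N U E V2 x2 y2 -> [/\ V1 = V2, x1 = x2, y1 = x1 & y2 = x2].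
Proof.
case: N => [|[|[|[|k]]]] //=.
- by move=> -> /stage1[-> -> ->] /stage1[-> -> ->].
- by move=> [-> ->] /stage2[-> -> ->] /stage2[-> -> ->].
- by move=> [-> ->] /stage3[-> -> ->] /stage3[-> -> ->].
move=> L S1 S2; have [] := @stage_large_unique k.+2 _ _ _ _ _ _ _ _ isT L S1 S2.
have [y1E _ _ _ _] := @stage_large k.+2 _ _ _ _ _ isT L S1.
by have [y2E _ _ _ _] := @stage_large k.+2 _ _ _ _ _ isT L S2.
Qed.

Lemma stage_exists N U E : admissible N U E -> exists V x, stage N U E V x x.
Proof.
case: N => [|[|[|[|k]]]] //=.
- by move=> ->; exists 2, (1 / 2); exact: stage1_exists.
- by move=> [-> ->]; exists (8 / 3), (1 / 2); exact: stage2_exists.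
- by move=> [-> ->]; exists 4, (1 / 2); exact: stage3_exists.
exact: stage_large_exists.
Qed.

Lemma admissible_step N U E V x y : admissible N U E -> stage N U E V x y ->
  admissible N.+1 V (V - U).
Proof.
case: N => [|[|[|[|k]]]] //=.
- by move=> -> /stage1[-> _ _]; split => //; ring.
- by move=> [-> ->] /stage2[-> _ _]; split => //; field.
- by move=> [-> ->] /stage3[-> _ _]; split; rewrite ?expr2; lra.
by move=> L S; exact: large_step S.
Qed.

Definition next_stage N U E : R * R :=
  xget (0, 0) [set Vx : R * R | stage N U E Vx.1 Vx.2 Vx.2]%classic.

Lemma next_stageP N U E : admissible N U E ->
  stage N U E (next_stage N U E).1 (next_stage N U E).2 (next_stage N U E).2.
Proof.
move=> A; have [V [x S]] := stage_exists A.
by have := @xgetPex _ (0, 0) [set Vx : R * R | stage N U E Vx.1 Vx.2 Vx.2]%classic; apply; exists (V, x).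
Qed.

(* [stages m] is [(W_{m+1}, W_m, p_{m+1})]; the value [W_0 := 1] is never used. *)
Fixpoint stages m : R * R * R :=
  if m is m'.+1 then
    let: (U, T, _) := stages m' in
    let: (V, x) := next_stage m U (U - T) in (V, U, x)
  else (1, 1, 0).

Definition eqlat m : R := if m is m'.+1 then (stages m').1.1 else 1.
Definition eqprob m : R := (stages m.-1).2.

Lemma stages_prev m : (stages m).1.2 = eqlat m.
Proof. by case: m => //= m; case: (stages m) => -[U T] x; case: next_stage. Qed.

Lemma admissible_eqlat m : admissible m.+1 (eqlat m.+1) (eqlat m.+1 - eqlat m) /\
  stage m.+1 (eqlat m.+1) (eqlat m.+1 - eqlat m) (eqlat m.+2) (eqprob m.+2) (eqprob m.+2).
Proof.
have A m' : admissible m'.+1 (eqlat m'.+1) (eqlat m'.+1 - eqlat m') ->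
  stage m'.+1 (eqlat m'.+1) (eqlat m'.+1 - eqlat m') (eqlat m'.+2) (eqprob m'.+2) (eqprob m'.+2).
  move=> A'; have := next_stageP A'; rewrite /= /eqprob -stages_prev /=.
  by case: (stages m') => -[U T] x /=; case: next_stage.
suff H : admissible m.+1 (eqlat m.+1) (eqlat m.+1 - eqlat m) by split => //; exact: A.
by elim: m => [|m IH] //; exact: admissible_step IH (A _ IH).
Qed.

Lemma eqlat_small : [/\ eqlat 1 = 1, eqlat 2 = 2, eqlat 3 = 8 / 3 & eqlat 4 = 4].
Proof.
have [_ S1] := admissible_eqlat 0; have [[e2 _] S2] := admissible_eqlat 1.
have [[e3 d3] S3] := admissible_eqlat 2; split => //.
by move: S3; rewrite d3 e3 => /stage3[].
Qed.

End EquilibriumSequence.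

(** * Size of the root and growth of the latency *)

Section RootEstimates.
Variable R : realType.
Implicit Types (u U V E : R).

Lemma expR_half_le u : 0 <= u <= 1 -> expR (u / 2) <= 1 + u.
Proof.
move=> hu; have h := expR_ge1Dx (- (u / 2)); have e0 := expR_gt0 (u / 2).
have e1 : expR (- (u / 2)) * expR (u / 2) = 1 by rewrite -expRD addNr expR0.
have : (1 - u / 2) * expR (u / 2) <= 1 by rewrite -[X in _ <= X]e1; apply: ler_wpM2r; lra.
have : 1 <= (1 + u) * (1 - u / 2) by nra.
set e := expR (u / 2) in e0 *; move=> a b.
rewrite -(@ler_pM2l _ (1 - u / 2)); lra.
Qed.

(** Origin of the [8]: since [V - U <= U], [exp (s/2) <= (1 + u)^(k+2) <= U (2 + s)], and
    [2 + s <= 4 exp (s/4) <= U exp (s/4)], so [exp (s/4) <= U^2]. The bounds on [V - U] use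
    [1/3 <= 1 - tauS <= 1] and [bS E <= U / 2]. *)
Lemma root_bounds k U E V x y : (2 <= k)%N -> large k U E -> stage k.+2 U E V x y ->
  let u := x / (1 - x) in let s := k.+2%:R * u in
  [/\ ln U <= s, s <= 8 * ln U, U <= 2 * s * (V - U), (V - U) * (s - 1) <= 3 * U &
      V - U <= U].
Proof.
move=> k2 L S u s; have [U4 E0 E2 Uk _] := L.
have [_ hx UV hd hn] := stage_large k2 L S; rewrite -/u in hd hn.
have uI : 0 <= u <= 1 by rewrite divr_ge0 ?ler_pdivrMr //; lra.
have [u0 u1] := andP uI.
have D0 : 0 <= V - U by lra.
have DU := latency_at_most_doubles k2 uI U4 E0 hd hn.
have d1 := dS_ge1 k uI.
have t0 := tauS_ge0 k uI.
have t1 : tauS k u <= 2 / 3 by exact: pow_le23.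
have hk := root_gt k2 uI U4 D0 hd.
have s1 : 1 <= s by rewrite /s -natr1; lra.
have XU : U <= (1 + u) ^+ k.+2 by have : 0 <= (V - U) * dS k u by [apply: mulr_ge0; lra]; lra.
have Xs : (1 + u) ^+ k.+2 <= expR s by exact: pow_le_expR.
have U0 : 0 < U by lra.
have ds : dS k u <= 1 + s.
  by rewrite /dS -/s; have : 0 <= tauS k u * (1 - u) by [apply: mulr_ge0; lra]; lra.
have b0 : 0 <= bS k u by rewrite /bS mulr_ge0 // mulr_ge0.
have b1 : bS k u <= 1.
  apply: le_trans (sqr_pow_le1 k2 uI); rewrite /bS /tauS.
  have -> : (k.+2%:R * u) ^+ 2 * (1 - u) ^+ k = k.+2%:R * u * (1 - u) ^+ k * (k.+2%:R * u) by ring.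
  apply: ler_wpM2l; first exact: tauS_ge0.
  by apply: ler_wpM2r; [lra | rewrite ler_nat].
have bE := ler_wpM2r E0 b1; have bE0 := mulr_ge0 b0 E0.
rewrite /nS -/s in hn.
split => //.
- by rewrite -ler_expR lnK // (le_trans XU).
- have h1 : expR (s / 2) <= U * (2 + s).
    apply: (@le_trans _ _ ((1 + u) ^+ k.+2)).
      rewrite /s -mulrA expRM_natl; apply: lerXn2r; rewrite ?nnegrE ?expR_ge0 //; first lra.
      exact: expR_half_le.
    have h : (V - U) * dS k u <= U * (1 + s) by apply: ler_pM => //; exact: le_trans d1.
    by clear -h hd; lra.
  have h2 : 2 + s <= 4 * expR (s / 4) by have := expR_ge1Dx (s / 4); lra.
  have h3 : expR (s / 4) <= U ^+ 2.
    have e0 := expR_gt0 (s / 4).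
    have e : expR (s / 2) = expR (s / 4) * expR (s / 4) by rewrite -expRD; congr expR; field.
    rewrite -(ler_pM2r e0) -e; apply: le_trans h1 _.
    have := ler_wpM2l (ltW U0) h2.
    have : U * (4 * expR (s / 4)) <= U * (U * expR (s / 4)).
      by rewrite ler_wpM2l ?(ltW U0) // ler_wpM2r // ltW.
    rewrite expr2; clear; lra.
  have : ln (expR (s / 4)) <= ln (U ^+ 2) by rewrite ler_ln ?posrE ?expR_gt0 ?exprn_gt0.
  rewrite expRK lnXn // -mulr_natl; lra.
- have : (V - U) * ((s - 1) * (1 - tauS k u)) <= (V - U) * s.
    apply: ler_wpM2l => //; apply: le_trans (_ : s - 1 <= _); last by rewrite gerBl.
    by rewrite ler_piMr ?subr_ge0 // gerBl.
  clear -hn bE E2 ; lra.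
have : (V - U) * (s - 1) * (1 / 3) <= (V - U) * ((s - 1) * (1 - tauS k u)).
  rewrite -mulrA; by apply: ler_wpM2l => //; apply: ler_wpM2l; clear -s1 t1; lra.
by clear -hn bE0; lra.
Qed.

Lemma eqlat_large k : (2 <= k)%N -> let U : R := eqlat R k.+2 in
  large k U (U - eqlat R k.+1) /\
  stage k.+2 U (U - eqlat R k.+1) (eqlat R k.+3) (eqprob R k.+3) (eqprob R k.+3).
Proof. by case: k => [|[|k]] // _; exact: (@admissible_eqlat R k.+3). Qed.

Lemma ln_step U V : 0 < U -> U <= V -> V <= 2 * U ->
  (V - U) / (2 * U) <= ln V - ln U <= (V - U) / U.
Proof.
move=> U0 UV VU; have tI : 0 <= (V - U) / U <= 1 by rewrite divr_ge0 ?ler_pdivrMr //; lra.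
have -> : ln V - ln U = ln (1 + (V - U) / U).
  have -> : 1 + (V - U) / U = V / U by field; lra.
  by rewrite ln_div ?posrE; lra.
have -> : (V - U) / (2 * U) = ((V - U) / U) / 2 by field; lra.
set t := (V - U) / U in tI *; have t0 : 0 < 1 + t by lra.
apply/andP; split; rewrite -ler_expR lnK ?posrE //; first exact: expR_half_le.
exact: expR_ge1Dx.
Qed.

End RootEstimates.

Section Asymptotics.
Variable R : realType.
Implicit Types (u U V : R).

(** A discrete [(l^2)' = 2 l l'] for [l = ln W_m]: a step raises [l] by at least [1 / (32 l)] and by
    at most [6 / l] and [1], so [l^2] grows by at least [2/32] and at most [2 * 6 + 1]. *)
Lemma ln_eqlat_sq m : (4 <= m)%N -> m%:R / 16 <= ln (eqlat R m) ^+ 2 <= 13 * m%:R.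
Proof.
move=> m4; rewrite -(subnK m4); elim: (m - 4)%N => [|j IH].
  have [_ _ _ ->] := eqlat_small R.
  have h1 : 1 <= ln (4 : R).
    by rewrite -ler_expR lnK ?posrE //; have := expR1_le R; lra.
  have h2 : ln (4 : R) <= 3 by rewrite -ler_expR lnK ?posrE //; have := expR_ge1Dx (3 : R); lra.
  by rewrite add0n expr2; nra.
have k2 : (2 <= j.+2)%N by [].
have [] := eqlat_large R k2; rewrite addSn addn4 in IH *.
set U := eqlat R _ in IH *; set V := eqlat R j.+1.+4 => L S.
have [ls sl h1 h2 h3] := root_bounds k2 L S.
have [U4 E0 E2 Uk _] := L.
have [_ _ UV _ _] := stage_large k2 L S.
have /andP[i1 i2] : (V - U) / (2 * U) <= ln V - ln U <= (V - U) / U by apply: ln_step; lra.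
have {IH} /andP[IH1 IH2] := IH.
have L1 : 1 <= ln U by rewrite -ler_expR lnK ?posrE; have := expR1_le R; lra.
move: ls sl h1 h2 {S}; set s := _ * _ => ls sl h1 h2.
clear k2 m4 m L E0 Uk E2.
set l := ln U in IH1 IH2 L1 i1 i2 ls sl *; set l' := ln V in i1 i2 *.
clearbody l l' U V s.
have a1 : 1 <= 32 * l * (l' - l).
  have : 1 <= 32 * l * ((V - U) / (2 * U)).
    rewrite mulrA ler_pdivlMr; last lra.
    have : s * (V - U) <= 8 * l * (V - U) by apply: ler_wpM2r; lra.
    lra.
  by move/le_trans; apply; apply: ler_wpM2l; lra.
have a2 : l' - l <= 1 by apply: le_trans i2 _; rewrite ler_pdivrMr; lra.
have a3 : l * (l' - l) <= 6.
  have [s2|s2] := lerP 2 s; last by have : 0 <= l' - l by [nra]; nra.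
  apply: (@le_trans _ _ (l * ((V - U) / U))); first by apply: ler_wpM2l; lra.
  rewrite mulrA ler_pdivrMr; last lra.
  have : l * (V - U) <= s * (V - U) by apply: ler_wpM2r; lra.
  have : s * (V - U) <= 2 * (s - 1) * (V - U) by apply: ler_wpM2r; lra.
  lra.
have a4 : 0 <= l' - l by nra.
rewrite -[j.+1.+4%:R]natr1.
have -> : l' ^+ 2 = l ^+ 2 + 2 * (l * (l' - l)) + (l' - l) ^+ 2 by ring.
have a5 : 0 <= (l' - l) ^+ 2 <= 1 by rewrite sqr_ge0 exprn_ile1.
lra.
Qed.

Lemma sqrt_le_of_sqr (x y : R) : 0 <= y -> x <= y ^+ 2 -> Num.sqrt x <= y.
Proof. by move=> y0 h; rewrite -(ger0_norm y0) -sqrtr_sqr ler_wsqrtr. Qed.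

Lemma le_sqrt_of_sqr (x y : R) : 0 <= x -> x ^+ 2 <= y -> x <= Num.sqrt y.
Proof. by move=> x0 h; rewrite -(ger0_norm x0) -sqrtr_sqr ler_wsqrtr. Qed.

Lemma eqlat_ge4 m : (4 <= m)%N -> 4 <= eqlat R m.
Proof. by case: m => // -[//|k] k2; have [[U4 _ _ _ _] _] := eqlat_large R k2. Qed.

Lemma ln_eqlat_bounds m : (4 <= m)%N ->
  1 / 4 * Num.sqrt m%:R <= ln (eqlat R m) <= 4 * Num.sqrt m%:R.
Proof.
move=> m4; have /andP[h1 h2] := ln_eqlat_sq m4.
have L0 : 0 <= ln (eqlat R m) by rewrite ln_ge0 //; have := eqlat_ge4 m4; lra.
apply/andP; split.
  have : Num.sqrt (m%:R : R) <= 4 * ln (eqlat R m) by apply: sqrt_le_of_sqr; [lra | rewrite exprMn; lra].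
  lra.
have : ln (eqlat R m) / 4 <= Num.sqrt (m%:R : R).
  have m0 : 0 <= m%:R :> R by [].
  by apply: le_sqrt_of_sqr; [lra | rewrite exprMn; lra].
lra.
Qed.

Lemma eqlat_exp_bounds m : (4 <= m)%N ->
  expR (1 / 4 * Num.sqrt m%:R) <= eqlat R m <= expR (4 * Num.sqrt m%:R).
Proof.
move=> m4; have /andP[h1 h2] := ln_eqlat_bounds m4; have W0 : 0 < eqlat R m by have := eqlat_ge4 m4; lra.
have WE : eqlat R m = expR (ln (eqlat R m)) by rewrite lnK ?posrE.
by rewrite WE !ler_expR h1 h2.
Qed.

(** With [r = sqrt (m-1)], [(m-1) u] lies between [r / 4] and [32 r]. Passing from [u] to [p] costs
    a factor [2] below, and passing from [r] to [sqrt m] a factor [2] above. *)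
Lemma eqprob_bounds m : (5 <= m)%N ->
  1 / 8 / Num.sqrt m%:R <= eqprob R m /\ eqprob R m <= 64 / Num.sqrt m%:R.
Proof.
case: m => // -[//|[//|k]] k2.
have [L S] := eqlat_large R k2; have [ls sl _ _ _] := root_bounds k2 L S.
have [_ hx _ _ _] := stage_large k2 L S.
have /andP[b1 b2] := @ln_eqlat_bounds k.+2 k2.
move: ls sl; set l := ln _ in b1 b2 *; set x := eqprob R _ in hx *; set u := x / (1 - x) => ls sl.
set N : R := k.+2%:R in b1 b2 ls sl.
have N4 : 4 <= N by rewrite /N ler_nat.
have uE : u * (1 - x) = x by rewrite /u; field; lra.
have ux : u / 2 <= x /\ x <= u by nra.
rewrite -[k.+3%:R]natr1 -/N.
set r := Num.sqrt N in b1 b2; set r' := Num.sqrt (N + 1).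
have r0 : 0 < r by rewrite sqrtr_gt0; lra.
have rr : r ^+ 2 = N by rewrite sqr_sqrtr //; lra.
have r1 : 0 < r' by rewrite sqrtr_gt0; lra.
have rr' : r' ^+ 2 = N + 1 by rewrite sqr_sqrtr //; lra.
have c1 : r <= r' by rewrite ler_wsqrtr //; lra.
have c2 : r' <= 2 * r by apply: sqrt_le_of_sqr; [lra | rewrite exprMn rr; lra].
have f1 : r / 4 <= r ^+ 2 * u by rewrite rr; lra.
have f2 : r ^+ 2 * u <= 32 * r by rewrite rr; lra.
have g1 : 1 / 4 <= r * u by rewrite -(ler_pM2l r0); lra.
have g2 : r * u <= 32 by rewrite -(ler_pM2l r0); lra.
have u0 : 0 <= u by lra.
split.
  rewrite ler_pdivrMr //; have : r * u <= r' * u by apply: ler_wpM2r.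
  have : u / 2 * r' <= x * r' by apply: ler_wpM2r; lra.
  lra.
rewrite ler_pdivlMr //; have : r' * u <= 2 * r * u by apply: ler_wpM2r.
have : x * r' <= u * r' by apply: ler_wpM2r; lra.
lra.
Qed.

End Asymptotics.

(** * The contention game *)

Section Counts.
Variables (R : comNzRingType) (A : finType) (n : nat) (d : A -> R).
Hypothesis d1 : \sum_a d a = 1.
Implicit Types (f : {ffun 'I_n -> A}) (c : A).

Definition users f c := [set i | f i == c].

Lemma sum_family (Q : 'I_n -> pred A) :
  \sum_(f : {ffun 'I_n -> A}) (f \in family Q)%:R * \prod_i d (f i) = \prod_i \sum_(a | Q i a) d a.
Proof.
rewrite bigA_distr_big_dep [RHS]big_mkcond; apply: eq_bigr => f _.
by case: ifP; rewrite ?mul1r ?mul0r.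
Qed.

Lemma sum_neq c : \sum_(a | a != c) d a = 1 - d c.
Proof. by rewrite -d1 [in RHS](bigD1 c) //= addrAC subrr add0r. Qed.

Lemma sum_neq2 c c' : c != c' -> \sum_(a | (a != c) && (a != c')) d a = 1 - d c - d c'.
Proof.
move=> cc'; rewrite -sum_neq [in RHS](bigD1 c') /=; last by rewrite eq_sym.
by rewrite addrAC subrr add0r.
Qed.

Lemma sum_pred1 c : \sum_(a | a == c) d a = d c.
Proof. by rewrite big_pred1_eq. Qed.

(** Naming the single user turns the event into a disjoint union of product events, to which
    [sum_family] applies. *)
Lemma card1_sum (T : finType) (S : {set T}) :
  (#|S| == 1%N)%:R = \sum_j (S == [set j])%:R :> R.
Proof.
have [/cards1P[j ->]|h] := boolP (#|S| == 1%N).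
  rewrite (bigD1 j) //= eqxx big1 ?addr0 // => i ij.
  by rewrite (inj_eq set1_inj) eq_sym (negbTE ij).
by rewrite big1 // => j _; case: eqP => // Sj; move: h; rewrite Sj cards1.
Qed.

Lemma prob_total : \sum_(f : {ffun 'I_n -> A}) \prod_i d (f i) = 1.
Proof. by rewrite -(bigA_distr_bigA (fun=> d)) big1 // => i _. Qed.

Lemma prob_none c : \sum_(f : {ffun 'I_n -> A}) (#|users f c| == 0%N)%:R * \prod_i d (f i) = (1 - d c) ^+ n.
Proof.
transitivity (\sum_(f : {ffun 'I_n -> A}) (f \in family (fun=> [pred a | a != c]))%:R * \prod_i d (f i)).
  apply: eq_bigr => f _; congr (_%:R * _); congr nat_of_bool.
  rewrite cards_eq0; apply/eqP/familyP => [S0 i|H].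
    by move/setP/(_ i): S0; rewrite !inE => ->.
  by apply/setP => i; have := H i; rewrite !inE => /negbTE.
by rewrite sum_family prodr_const card_ord /= -sum_neq.
Qed.

Lemma prod_pick (j : 'I_n) (u v : R) :
  \prod_i (if i == j then u else v) = u * v ^+ n.-1.
Proof.
rewrite (bigD1 j) //= eqxx; congr (_ * _).
rewrite (eq_bigr (fun=> v)) => [|i /negbTE ->//].
by rewrite prodr_const cardC1 card_ord.
Qed.

Lemma prob_one c :
  \sum_(f : {ffun 'I_n -> A}) (#|users f c| == 1%N)%:R * \prod_i d (f i) = n%:R * d c * (1 - d c) ^+ n.-1.
Proof.
transitivity (\sum_(j < n) \sum_f
    (f \in family (fun i => [pred a | (a == c) == (i == j)]))%:R * \prod_i d (f i)).
  rewrite exchange_big; apply: eq_bigr => f _.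
  rewrite card1_sum mulr_suml; apply: eq_bigr => j _; congr (_%:R * _); congr nat_of_bool.
  apply/eqP/familyP => [/setP S i|H]; first by have := S i; rewrite !inE => ->.
  by apply/setP => i; have := H i; rewrite !inE => /eqP.
rewrite (eq_bigr (fun=> d c * (1 - d c) ^+ n.-1)) => [|j _].
  by rewrite sumr_const card_ord -[LHS]mulr_natl mulrA.
rewrite sum_family -(prod_pick j); apply: eq_bigr => i _ /=.
case: ifP => _; first by rewrite -[RHS]sum_pred1; apply: eq_bigl => a; rewrite eqb_id.
by rewrite -sum_neq; apply: eq_bigl => a; rewrite eqbF_neg.
Qed.

Lemma prob_none_one c c' : c != c' ->
  \sum_(f : {ffun 'I_n -> A}) ((#|users f c| == 0%N) && (#|users f c'| == 1%N))%:R * \prod_i d (f i) =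
  n%:R * d c' * (1 - d c - d c') ^+ n.-1.
Proof.
move=> cc'; transitivity (\sum_(j < n) \sum_f
    (f \in family (fun i => [pred a | (a != c) && ((a == c') == (i == j))]))%:R * \prod_i d (f i)).
  rewrite exchange_big; apply: eq_bigr => f _.
  rewrite -mulnb natrM card1_sum mulr_sumr mulr_suml; apply: eq_bigr => j _.
  rewrite -natrM mulnb; congr (_%:R * _); congr nat_of_bool.
  rewrite cards_eq0; apply/andP/familyP => [[/eqP/setP S0 /eqP/setP S] i|H].
    by have := S i; have := S0 i; rewrite !inE => -> ->; rewrite eqxx.
  split; apply/eqP/setP => i; have := H i; rewrite !inE => /andP[/negbTE] //.
  by move=> _ /eqP.
rewrite (eq_bigr (fun=> d c' * (1 - d c - d c') ^+ n.-1)) => [|j _].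
  by rewrite sumr_const card_ord -[LHS]mulr_natl mulrA.
rewrite sum_family -(prod_pick j); apply: eq_bigr => i _ /=.
case: ifP => _.
  rewrite -[RHS]sum_pred1; apply: eq_bigl => a; rewrite eqb_id andb_idl // => /eqP ->.
  by rewrite eq_sym.
by rewrite -sum_neq2 //; apply: eq_bigl => a; rewrite eqbF_neg.
Qed.

Lemma prob_one_one c c' : c != c' ->
  \sum_(f : {ffun 'I_n -> A}) ((#|users f c| == 1%N) && (#|users f c'| == 1%N))%:R * \prod_i d (f i) =
  n%:R * n.-1%:R * d c * d c' * (1 - d c - d c') ^+ n.-2.
Proof.
move=> cc'; transitivity (\sum_(j < n) \sum_(l < n) \sum_f
    (f \in family (fun i => [pred a | ((a == c) == (i == j)) && ((a == c') == (i == l))]))%:R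
      * \prod_i d (f i)).
  under [RHS]eq_bigr do rewrite exchange_big.
  rewrite exchange_big; apply: eq_bigr => f _.
  rewrite -mulnb natrM card1_sum mulr_suml mulr_suml; apply: eq_bigr => j _.
  rewrite card1_sum mulr_sumr mulr_suml; apply: eq_bigr => l _.
  rewrite -natrM mulnb; congr (_%:R * _); congr nat_of_bool.
  apply/andP/familyP => [[/eqP/setP S /eqP/setP S'] i|H].
    by have := S i; have := S' i; rewrite !inE => -> ->; rewrite !eqxx.
  by split; apply/eqP/setP => i; have := H i; rewrite !inE => /andP[/eqP ? /eqP ?].
rewrite (eq_bigr (fun=> n.-1%:R * (d c * d c' * (1 - d c - d c') ^+ n.-2))) => [|j _].
  by rewrite sumr_const card_ord -[LHS]mulr_natl !mulrA.
(* The term [l = j] vanishes: one player cannot be on both channels. *)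
rewrite (bigD1 j) //= sum_family (bigD1 j) //= eqxx.
rewrite big_pred0 ?mul0r ?add0r; last first.
  by move=> a; rewrite !eqb_id; case: eqP => // ->; rewrite (negbTE cc').
rewrite (eq_bigr (fun=> d c * d c' * (1 - d c - d c') ^+ n.-2)) => [|l lj].
  by rewrite sumr_const cardC1 card_ord -[LHS]mulr_natl.
rewrite sum_family (bigD1 j) //= eqxx (bigD1 l) //= eqxx (negbTE lj) eq_sym (negbTE lj) mulrA.
congr (_ * _ * _).
- rewrite -[RHS]sum_pred1; apply: eq_bigl => a; rewrite eqb_id eqbF_neg andb_idr // => /eqP ->.
  by [].
- rewrite -[RHS]sum_pred1; apply: eq_bigl => a; rewrite eqb_id eqbF_neg andb_idl // => /eqP ->.
  by rewrite eq_sym.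
rewrite (eq_bigr (fun=> 1 - d c - d c')) => [|i /andP[ij il]].
  rewrite prodr_const; congr (_ ^+ _).
  have -> : n.-2 = #|[predC [:: j; l]]|.
    have h := cardC (mem [:: j; l]); rewrite card_ord (card_uniqP _) /= in h.
      exact: esym (congr1 (fun t => t.-2) h).
    by rewrite inE eq_sym lj.
  by apply: eq_card => i; rewrite !inE negb_or.
by rewrite (negbTE ij) (negbTE il) -sum_neq2 //; apply: eq_bigl => a; rewrite !eqbF_neg.
Qed.

End Counts.

(** * Expected continuation after one slot *)

Section OneSlot.
Variables (R : realType) (k : nat).
Implicit Types (d : action k -> R) (g : nat -> R) (m : nat) (a : action k).

(** Profiles in which the tagged player succeeds contribute zero, as they leave no further
    latency. *)
Definition cont d m a g : R := \sum_(m' < m.+1) trans d m a m' * g m'.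

Lemma contE d m a g : cont d m a g =
  \sum_(f : {ffun 'I_m.-1 -> action k} | ~~ tagged_success f a)
     profile_prob d f * g (m - n_success f a)%N.
Proof.
rewrite /cont.
rewrite (partition_big (fun f : {ffun 'I_m.-1 -> action k} => inord (m - n_success f a) : 'I_m.+1) xpredT) //=.
apply: eq_bigr => m' _; rewrite /trans mulr_suml.
have e (f : {ffun 'I_m.-1 -> action k}) : (inord (m - n_success f a) == m' :> 'I_m.+1) = ((m - n_success f a)%N == m').
  by rewrite -(inj_eq val_inj) /= inordK // ltnS leq_subr.
by apply: eq_big => [f|f /andP[_ /eqP <-]]; rewrite ?e.
Qed.

(** Each successful channel is charged to its own opponent. Hence continuations only evaluate [g]
    between [1] and [m], and comparisons can be restricted to the range where the protocol is a
    distribution. *)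
Lemma n_success_lt m a (f : {ffun 'I_m.-1 -> action k}) : (0 < m)%N ->
  ~~ tagged_success f a -> (n_success f a < m)%N.
Proof.
move=> m0 nt; suff H : (n_success f a <= m.-1)%N by apply: leq_ltn_trans H _; rewrite prednK.
rewrite /n_success -sum1_card.
rewrite (eq_bigr (fun c => #|[set i | f i == c]|)); last first.
  move=> c; rewrite inE => /andP[c0 /eqP]; rewrite /chan_count.
  case: eqP => [ac|_]; last by rewrite addn0.
  rewrite addn1 => -[S0]; move: nt; rewrite /tagged_success ac c0 /=.
  by rewrite S0.
rewrite -[X in (_ <= X)%N]card_ord -sum1_card (partition_big f xpredT) //=.
rewrite [X in (X <= _)%N]big_mkcond; apply: leq_sum => c _.
case: ifP => // _; rewrite -sum1_card leq_eqVlt; apply/orP; left; apply/eqP.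
by apply: eq_bigl => i; rewrite inE.
Qed.

Lemma profile_prob_ge0 d m (f : {ffun 'I_m.-1 -> action k}) : is_dist d -> 0 <= profile_prob d f.
Proof. by case=> d0 _; apply: prodr_ge0. Qed.

Lemma cont_le d m a g h : (0 < m)%N -> is_dist d ->
  (forall m', (0 < m' <= m)%N -> g m' <= h m') -> cont d m a g <= cont d m a h.
Proof.
move=> m0 dd gh; rewrite !contE; apply: ler_sum => f nt.
apply: ler_wpM2l; first exact: profile_prob_ge0.
by apply: gh; rewrite subn_gt0 leq_subr n_success_lt.
Qed.

Lemma contD d m a g h : cont d m a (fun m' => g m' + h m') = cont d m a g + cont d m a h.
Proof. by rewrite /cont -big_split; apply: eq_bigr => i _; rewrite mulrDr. Qed.

Lemma contZ d m a (c : R) g : cont d m a (fun m' => c * g m') = c * cont d m a g.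
Proof. by rewrite /cont mulr_sumr; apply: eq_bigr => i _; rewrite mulrCA. Qed.

Lemma cont_ge0 d m a g : (0 < m)%N -> is_dist d ->
  (forall m', (0 < m' <= m)%N -> 0 <= g m') -> 0 <= cont d m a g.
Proof.
move=> m0 dd g0; rewrite contE; apply: sumr_ge0 => f nt.
apply: mulr_ge0; first exact: profile_prob_ge0.
by apply: g0; rewrite subn_gt0 leq_subr n_success_lt.
Qed.

Lemma cont_sum d m a t (F : nat -> nat -> R) :
  cont d m a (fun m' => \sum_(i < t) F i m') = \sum_(i < t) cont d m a (F i).
Proof.
rewrite /cont exchange_big; apply: eq_bigr => i _; by rewrite mulr_sumr.
Qed.

Lemma cont1_le d m a : is_dist d -> cont d m a (fun=> 1) <= 1.
Proof.
move=> dd; rewrite contE -[X in _ <= X](@prob_total R (action k) m.-1 d dd.2) big_mkcond /=.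
apply: ler_sum => f _; case: ifP => _; rewrite ?mulr1 //.
exact: profile_prob_ge0.
Qed.

End OneSlot.

Section TwoChannels.
Variable R : realType.
Implicit Types (d : action 2 -> R) (g : nat -> R) (m : nat).

Lemma sum_action2 (F : action 2 -> R) : \sum_a F a = F ord0 + F ch1 + F ch2.
Proof.
rewrite !big_ord_recl big_ord0 addr0 addrA.
by congr (_ + F _ + F _); apply: val_inj.
Qed.

Lemma n_success2 m (f : {ffun 'I_m.-1 -> action 2}) a :
  n_success f a = ((chan_count f a ch1 == 1) + (chan_count f a ch2 == 1))%N.
Proof.
rewrite /n_success -sum1dep_card big_mkcond !big_ord_recl big_ord0 /=.
rewrite (_ : lift ord0 ord0 = ch1); last exact: val_inj.
rewrite (_ : lift ord0 (lift ord0 ord0) = ch2); last exact: val_inj.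
by rewrite add0n addn0; do 2 case: (_ == 1%N).
Qed.

Lemma cont0 d m g : is_dist d ->
  cont d m ord0 g = g m - gain0 m.-1 (g m - g m.-1) (g m.-1 - g m.-2) (d ch1) (d ch2).
Proof.
move=> [_ d1]; rewrite contE /tagged_success eqxx /=.
set D := g m - g m.-1; set E := g m.-1 - g m.-2.
pose s1 (f : {ffun 'I_m.-1 -> action 2}) : bool := #|users f ch1| == 1%N.
pose s2 (f : {ffun 'I_m.-1 -> action 2}) : bool := #|users f ch2| == 1%N.
(* [g (m - s1 - s2)] as a polynomial in the two success indicators; the mixed coefficient [D - E] is
   a second difference of [g]. *)
transitivity (\sum_(f : {ffun 'I_m.-1 -> action 2}) (g m * \prod_i d (f i)
    - D * ((s1 f)%:R * \prod_i d (f i)) - D * ((s2 f)%:R * \prod_i d (f i))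
    + (D - E) * ((s1 f && s2 f)%:R * \prod_i d (f i)))).
  apply: eq_bigr => f _; rewrite n_success2 /chan_count !addn0 /profile_prob.
  rewrite -/(users f ch1) -/(users f ch2) -/(s1 f) -/(s2 f) /D /E.
  by case: (s1 f); case: (s2 f); rewrite /= ?subn0 ?subn1 ?subn2 /=; ring.
rewrite !big_split /= !sumrN -!mulr_sumr prob_total // !prob_one // prob_one_one //.
by rewrite /gain0; ring.
Qed.

(** If [c] has another user, all its users collide and only a lone user of [c'] can leave. *)
Lemma cont_channel d m g c c' : is_dist d -> (c, c') = (ch1, ch2) \/ (c, c') = (ch2, ch1) ->
  cont d m c g = g m - gain1 m.-1 (g m) (g m - g m.-1) (d c) (d c').
Proof.
move=> [_ d1] cc; rewrite contE.
have [c0 c0' cc'] : [/\ c != ord0, c' != ord0 & c != c'] by case: cc => -[-> ->].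
set D := g m - g m.-1.
pose z1 (f : {ffun 'I_m.-1 -> action 2}) : bool := #|users f c| == 0%N.
pose s2 (f : {ffun 'I_m.-1 -> action 2}) : bool := #|users f c'| == 1%N.
transitivity (\sum_(f : {ffun 'I_m.-1 -> action 2}) (g m * \prod_i d (f i)
    - g m * ((z1 f)%:R * \prod_i d (f i)) - D * ((s2 f)%:R * \prod_i d (f i))
    + D * ((z1 f && s2 f)%:R * \prod_i d (f i)))).
  rewrite big_mkcond; apply: eq_bigr => f _; rewrite /tagged_success c0 /=.
  rewrite -/(users f c) -/(z1 f); case z: (z1 f) => /=; first by case: (s2 f); ring.
  have -> : n_success f c = s2 f :> nat.
    have e' : (#|users f c| + 1 == 1)%N = false by rewrite addn1 eqSS -/(z1 f) z.
    rewrite n_success2 /chan_count /s2; case: cc e' => -[-> ->] /= ->.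
      by rewrite add0n addn0.
    by rewrite addn0 addn0.
  by rewrite /profile_prob /D; case: (s2 f); rewrite /= ?subn0 ?subn1; ring.
rewrite !big_split /= !sumrN -!mulr_sumr prob_total // prob_none // prob_one // prob_none_one //.
by rewrite /gain1; ring.
Qed.

Lemma dist2 d : is_dist d -> d ord0 = 1 - d ch1 - d ch2.
Proof. by case=> _; rewrite sum_action2 => <-; ring. Qed.

End TwoChannels.

(** * Truncated latencies and verification by Bellman inequalities *)

Section Latency.
Variables (R : realType) (k : nat).
Implicit Types (q : protocol R k) (s : strategy R k) (m t : nat).

Lemma nneseries_le_bound (u : nat -> R) B : (forall i, 0 <= u i) ->
  (forall t, \sum_(i < t) u i <= B) -> (\sum_(0 <= i <oo) (u i)%:E <= B%:E)%E.
Proof.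
move=> u0 H; apply: lime_le; first by apply: is_cvg_nneseries => i _ _; rewrite lee_fin.
by apply: nearW => t; rewrite sumEFin lee_fin big_mkord.
Qed.

Lemma partial_le_nneseries (u : nat -> R) t : (forall i, 0 <= u i) ->
  ((\sum_(i < t) u i)%:E <= \sum_(0 <= i <oo) (u i)%:E)%E.
Proof.
move=> u0; have := @nneseries_lim_ge R (fun i => (u i)%:E) xpredT 0 t.
by rewrite sumEFin big_mkord; apply => i _ _; rewrite lee_fin.
Qed.

Definition after s a m' : strategy R k := fun h => s ((a, m') :: h).

Lemma survS q t s m : surv q t.+1 s m =
  \sum_a s [::] a * cont (q m) m a (fun m' => surv q t (after s a m') m').
Proof. by []. Qed.

(** The expectation of [min T t] for the latency [T], which obeys a finite-horizon recursion. *)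
Definition slots q t s m : R := \sum_(i < t) surv q i s m.

Lemma slotsS q t s m : slots q t.+1 s m =
  1 + \sum_a s [::] a * cont (q m) m a (fun m' => slots q t (after s a m') m').
Proof.
rewrite /slots big_ord_recl; congr (1 + _).
under eq_bigr => i _ do rewrite lift0 survS.
rewrite exchange_big; apply: eq_bigr => a _.
by rewrite /slots (cont_sum _ _ _ t (fun i m' => surv q i (after s a m') m')) mulr_sumr.
Qed.

Lemma is_dist_avg_le (d : action k -> R) (F G : action k -> R) : is_dist d ->
  (forall a, F a <= G a) -> \sum_a d a * F a <= \sum_a d a * G a.
Proof. by move=> [d0 _] FG; apply: ler_sum => a _; apply: ler_wpM2l. Qed.

Lemma is_dist_avg_cst (d : action k -> R) c : is_dist d -> \sum_a d a * c = c.
Proof. by move=> [_ d1]; rewrite -mulr_suml d1 mul1r. Qed.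

Lemma valid_after s a m' : valid_strategy s -> valid_strategy (after s a m').
Proof. by move=> vs h; exact: vs. Qed.

Lemma surv_ge0 n q t s m : valid_protocol n q -> valid_strategy s ->
  (1 <= m <= n)%N -> 0 <= surv q t s m.
Proof.
move=> vq; elim: t s m => [|t IH] s m vs hm //; rewrite survS.
apply: sumr_ge0 => a _; apply: mulr_ge0; first by case: (vs [::]).
have /andP[m0 mn] := hm; apply: cont_ge0 => //; first exact: vq.
move=> m' /andP[m'0 m'm]; apply: IH; [exact: valid_after | by rewrite m'0 (leq_trans m'm)].
Qed.

(** A valid strategy must give a distribution after every history, even an impossible one, whereas
    [q] is known to do so only for [1 <= m <= n]. *)
Definition clip n q : protocol R k :=
  fun m => if (1 <= m <= n)%N then q m else fun a => (a == ord0)%:R.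

Lemma is_dist_delta (b : action k) : is_dist (fun a => (a == b)%:R : R).
Proof.
split=> [a|]; first exact: ler0n.
by rewrite (bigD1 b) //= eqxx big1 ?addr0 // => a /negbTE ->.
Qed.

Lemma clip_dist n q m : valid_protocol n q -> is_dist (clip n q m).
Proof. by move=> vq; rewrite /clip; case: ifP => [/vq //|_]; exact: is_dist_delta. Qed.

Lemma valid_clip n q m : valid_protocol n q -> valid_strategy (prot_strat (clip n q) m).
Proof. by move=> vq h; exact: clip_dist. Qed.

Lemma surv_clip n q q' t m : valid_protocol n q -> (1 <= m <= n)%N ->
  surv q t (prot_strat (clip n q') m) m = surv q t (prot_strat q' m) m.
Proof.
move=> vq; elim: t m => [|t IH] m hm //; rewrite !survS; apply: eq_bigr => a _.
have /andP[m0 mn] := hm; have dq := vq _ hm.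
congr (_ * _); first by rewrite /prot_strat /= /clip hm.
have E m' : (0 < m' <= m)%N ->
  surv q t (after (prot_strat (clip n q') m) a m') m' = surv q t (after (prot_strat q' m) a m') m'.
  by move=> /andP[m'0 m'm]; apply: IH; rewrite m'0 (leq_trans m'm).
by apply: le_anti; apply/andP; split; apply: cont_le => // m' /E ->.
Qed.

Lemma surv_prot_ge0 n q t m : valid_protocol n q -> (1 <= m <= n)%N ->
  0 <= surv q t (prot_strat q m) m.
Proof. by move=> vq hm; rewrite -(surv_clip q t vq hm); apply: (surv_ge0 t vq (valid_clip m vq) hm). Qed.

Section Verification.
Variables (n : nat) (q : protocol R k) (W : nat -> R).
Hypothesis vq : valid_protocol n q.
Hypothesis W0 : forall m, (1 <= m <= n)%N -> 0 <= W m.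
Hypothesis Wopt : forall m a, (1 <= m <= n)%N -> W m <= 1 + cont (q m) m a W.

Lemma value_le_slots M s m t : (forall m', (1 <= m' <= n)%N -> W m' <= M) -> valid_strategy s ->
  (1 <= m <= n)%N -> W m <= slots q t s m + M * surv q t s m.
Proof.
move=> WM; elim: t s m => [|t IH] s m vs hm.
  by rewrite /slots big_ord0 add0r mulr1; exact: WM.
have /andP[m0 mn] := hm; have dq := vq hm.
rewrite slotsS survS mulr_sumr -addrA -big_split /=.
rewrite -(is_dist_avg_cst (W m) (vs [::])) -[X in X + _](is_dist_avg_cst 1 (vs [::])) -big_split /=.
apply: ler_sum => a _.
rewrite mulrCA -!mulrDr; apply: ler_wpM2l; first by case: (vs [::]).
apply: le_trans (Wopt a hm) _; rewrite lerD2l -contZ -contD; apply: cont_le => //.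
move=> m' /andP[m'0 m'm]; apply: IH; [exact: valid_after | by rewrite m'0 (leq_trans m'm)].
Qed.

Lemma bounded_on_range : exists2 M, 0 < M & forall m', (1 <= m' <= n)%N -> W m' <= M.
Proof.
exists (1 + \sum_(i < n.+1) `|W i|); first by rewrite ltr_pwDl // sumr_ge0.
move=> m' /andP[_ m'n]; rewrite (bigD1 (inord m')) //= inordK ?ltnS //.
have : 0 <= \sum_(i < n.+1 | i != inord m') `|W i| by rewrite sumr_ge0.
by have := ler_norm (W m'); lra.
Qed.

(** If the latency were some [r < W m], [value_le_slots] would keep every survival probability at
    least [(W m - r) / M], and their sum would diverge. *)
Lemma value_le_latency s m : valid_strategy s -> (1 <= m <= n)%N ->
  ((W m)%:E <= latency q s m)%E.
Proof.
move=> vs hm; have s0 i := surv_ge0 i vq vs hm.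
have lb t := partial_le_nneseries t s0.
rewrite -/(latency q s m) in lb; case E: (latency q s m) => [r| |]; last 2 first.
- by rewrite leey.
- by have := lb 0%N; rewrite E big_ord0 leeNy_eq.
rewrite lee_fin leNgt; apply/negP => rW.
have [M M0 WM] := bounded_on_range.
have big i : (W m - r) / M <= surv q i s m.
  rewrite ler_pdivrMr //; have := value_le_slots i WM vs hm.
  by have := lb i; rewrite E lee_fin /slots; lra.
have e0 : 0 < (W m - r) / M by rewrite divr_gt0 //; lra.
have [t ht] : exists t : nat, r < t%:R * ((W m - r) / M).
  exists (Num.truncn (`|r| / ((W m - r) / M))).+1.
  have := truncnS_gt (`|r| / ((W m - r) / M)); rewrite ltr_pdivrMr // => h.
  by apply: le_lt_trans h; exact: ler_norm.
have := lb t; rewrite E lee_fin leNgt; apply/negP; rewrite negbK.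
apply: lt_le_trans ht _.
have -> : t%:R * ((W m - r) / M) = \sum_(i < t) (W m - r) / M by rewrite sumr_const card_ord mulr_natl.
exact: ler_sum.
Qed.

Lemma prot_latency_le m : (forall m', (1 <= m' <= n)%N ->
    1 + \sum_a q m' a * cont (q m') m' a W <= W m') ->
  (1 <= m <= n)%N -> (latency q (prot_strat q m) m <= (W m)%:E)%E.
Proof.
move=> H hm; apply: nneseries_le_bound => [i|t]; first exact: surv_prot_ge0 hm.
rewrite -/(slots q t _ _).
elim: t m hm => [|t IH] m hm; first by rewrite /slots big_ord0 W0.
have /andP[m0 mn] := hm; have dq := vq hm.
apply: le_trans (H _ hm); rewrite slotsS lerD2l; apply: is_dist_avg_le => // a.
apply: cont_le => // m' /andP[m'0 m'm]; apply: IH; by rewrite m'0 (leq_trans m'm).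
Qed.

End Verification.

End Latency.

(** * Every equilibrium solves the stage conditions *)

Section Necessity.
Variable R : realType.

Lemma exists_pos_lower_bound n (h : nat -> R) : (forall m, (1 <= m <= n)%N -> 0 < h m) ->
  exists2 e, 0 < e & forall m, (1 <= m <= n)%N -> e <= h m.
Proof.
elim: n => [|n IH] H; first by exists 1 => // m; case: m.
have [|e e0 he] := IH.
  by move=> m /andP[m1 mn]; apply: H; rewrite m1 leqW.
exists (Num.min e (h n.+1)); first by rewrite lt_min e0 H //= leqnn.
move=> m /andP[m1]; rewrite leq_eqVlt => /orP[/eqP ->|mn]; rewrite ge_min ?lexx ?orbT //.
by rewrite he // m1.
Qed.

Lemma is_dist_le1 k (d : action k -> R) a : is_dist d -> d a <= 1.
Proof. by move=> [d0 d1]; rewrite -d1 (bigD1 a) //= lerDl sumr_ge0. Qed.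

Variables (n : nat) (q : protocol R 2).
Hypothesis vq : valid_protocol n q.
Hypothesis eqq : equilibrium n q.

(* An action that succeeds with positive probability against [q]; repeating it has finite
   expected latency, so equilibrium latencies are finite. *)
Definition open_channel m : action 2 := if q m ch1 == 1 then ch2 else ch1.

Lemma open_channel_lt1 m : (1 <= m <= n)%N -> q m (open_channel m) < 1.
Proof.
move=> hm; have [d0 d1] := vq hm; rewrite sum_action2 in d1.
rewrite /open_channel; case: eqP => [h|/eqP h]; first by have := d0 ord0; lra.
by rewrite lt_neqAle h (is_dist_le1 _ (vq hm)).
Qed.

Lemma open_channel_cont m : (1 <= m <= n)%N ->
  cont (q m) m (open_channel m) (fun=> 1) = 1 - (1 - q m (open_channel m)) ^+ m.-1.
Proof.
move=> hm; rewrite /open_channel; case: eqP => _.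
  by rewrite (@cont_channel R (q m) m _ ch2 ch1 (vq hm)) ?/gain1 ?subrr ?mulr0 ?addr0 ?mulr1 //; right.
by rewrite (@cont_channel R (q m) m _ ch1 ch2 (vq hm)) ?/gain1 ?subrr ?mulr0 ?addr0 ?mulr1 //; left.
Qed.

(** The deviation to the open channel succeeds in each slot with probability at least [e], whatever
    [m], so its latency is at most [1 / e]. *)
Lemma latency_bounded : exists B, forall m, (1 <= m <= n)%N ->
  (latency q (prot_strat q m) m <= B%:E)%E.
Proof.
have [|e e0 he] := @exists_pos_lower_bound n (fun m => (1 - q m (open_channel m)) ^+ m.-1).
  by move=> m hm; rewrite exprn_gt0 // subr_gt0 open_channel_lt1.
pose q' m : action 2 -> R := fun a => (a == open_channel m)%:R.
have vq' m : valid_strategy (prot_strat q' m) by move=> h; exact: is_dist_delta.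
exists (e^-1) => m hm; apply: le_trans (eqq hm (vq' m)) _.
apply: nneseries_le_bound => [i|t]; first exact: (surv_ge0 _ vq (vq' m) hm).
rewrite -/(slots q t _ _); elim: t m hm => [|t IH] m hm.
  by rewrite /slots big_ord0 invr_ge0 ltW.
have /andP[m0 mn] := hm.
rewrite slotsS (bigD1 (open_channel m)) //= {1}/prot_strat {1}/q' eqxx mul1r big1; last first.
  by move=> a /negbTE na; rewrite {1}/prot_strat {1}/q' na mul0r.
rewrite addr0; apply: (@le_trans _ _ (1 + cont (q m) m (open_channel m) (fun=> e^-1 * 1))).
  rewrite lerD2l; apply: cont_le => //; first exact: vq.
  by move=> m' /andP[m'0 m'm]; rewrite mulr1; apply: IH; rewrite m'0 (leq_trans m'm).
rewrite contZ open_channel_cont // mulrBr mulr1.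
have : 1 <= e^-1 * (1 - q m (open_channel m)) ^+ m.-1.
  by rewrite mulrC ler_pdivlMr // mul1r he.
lra.
Qed.

Definition lat m : R := fine (latency q (prot_strat q m) m).

Lemma latE m : (1 <= m <= n)%N -> latency q (prot_strat q m) m = (lat m)%:E.
Proof.
move=> hm; have [B HB] := latency_bounded; have := HB m hm.
have : (0 <= latency q (prot_strat q m) m)%E.
  by apply: nneseries_ge0 => i _ _; rewrite lee_fin; exact: surv_prot_ge0 hm.
by rewrite /lat; case: (latency _ _ _).
Qed.

Lemma slots_le_lat t m : (1 <= m <= n)%N -> slots q t (prot_strat q m) m <= lat m.
Proof.
move=> hm; rewrite -lee_fin -latE //; apply: partial_le_nneseries => i; exact: surv_prot_ge0 hm.
Qed.

Lemma slots_mono m t t' : (1 <= m <= n)%N -> (t <= t')%N ->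
  slots q t (prot_strat q m) m <= slots q t' (prot_strat q m) m.
Proof.
move=> hm /subnK <-; elim: (t' - t)%N => [|j IH]; first by rewrite add0n.
apply: le_trans IH _; rewrite addSn /slots big_ord_recr /= lerDl.
exact: surv_prot_ge0 hm.
Qed.

(** Truncations increase and there are finitely many [m], so one horizon serves all; [cont_le_lat]
    needs this because the next number of players is random. *)
Lemma lat_approx (e : R) : 0 < e ->
  exists t, forall m, (1 <= m <= n)%N -> lat m - e <= slots q t (prot_strat q m) m.
Proof.
move=> e0.
have A m : (1 <= m <= n)%N -> exists t, lat m - e <= slots q t (prot_strat q m) m.
  move=> hm; apply: contrapT => H.
  have : (latency q (prot_strat q m) m <= (lat m - e)%:E)%E.
    apply: nneseries_le_bound => [i|t]; first exact: surv_prot_ge0 hm.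
    by rewrite leNgt; apply/negP => h; apply: H; exists t; exact: ltW.
  by rewrite latE // lee_fin; lra.
suff H j : (j <= n)%N -> exists t, forall m, (1 <= m <= j)%N -> lat m - e <= slots q t (prot_strat q m) m.
  exact: H.
elim: j => [|j IH] jn; first by exists 0%N => m; case: m.
have [t ht] := IH (ltnW jn); have [t' ht'] := A j.+1 jn.
exists (maxn t t') => m /andP[m0]; rewrite leq_eqVlt => /orP[/eqP -> |mj].
  by apply: le_trans ht' _; apply: slots_mono => //; exact: leq_maxr.
have mj' : (1 <= m <= j)%N by rewrite m0.
apply: le_trans (ht m mj') _; apply: slots_mono; last exact: leq_maxl.
rewrite m0 /=; exact: leq_trans (mj : (m <= j)%N) (ltnW jn).

Qed.

(** The one-shot deviation [s] plays [a] once and then returns to [q], clipped to be valid on all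
    histories. *)
Lemma lat_le_cont m a : (1 <= m <= n)%N -> lat m <= 1 + cont (q m) m a lat.
Proof.
move=> hm; have /andP[m0 mn] := hm.
pose s : strategy R 2 := fun h =>
  if h is (_, m') :: h' then clip n q (last m' (map snd h')) else fun b => (b == a)%:R.
have vs : valid_strategy s.
  by move=> [|[b m'] h] /=; [exact: is_dist_delta | exact: clip_dist].
rewrite -lee_fin -latE //; apply: le_trans (eqq hm vs) _.
apply: nneseries_le_bound => [i|t]; first exact: (surv_ge0 _ vq vs hm).
have c0 : 0 <= cont (q m) m a lat.
  apply: cont_ge0 => //; first exact: vq.
  move=> m' /andP[m'0 m'm]; have := @slots_le_lat 0 m'; rewrite /slots big_ord0; apply.
  by rewrite m'0 (leq_trans m'm).
case: t => [|t]; first by rewrite big_ord0; lra.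
rewrite -/(slots q t.+1 _ _) slotsS lerD2l (bigD1 a) //= eqxx mul1r big1; last first.
  by move=> b /negbTE ->; rewrite mul0r.
rewrite addr0; apply: cont_le => //; first exact: vq.
move=> m' /andP[m'0 m'm]; have hm' : (1 <= m' <= n)%N by rewrite m'0 (leq_trans m'm).
rewrite (_ : slots _ _ _ _ = slots q t (prot_strat q m') m'); first exact: slots_le_lat.
apply: eq_bigr => i _; exact: (surv_clip q i vq hm').
Qed.

Lemma cont_le_lat m : (1 <= m <= n)%N -> 1 + \sum_a q m a * cont (q m) m a lat <= lat m.
Proof.
move=> hm; have /andP[m0 mn] := hm; apply/ler_addgt0Pr => e e0.
have [t ht] := lat_approx e0.
apply: (@le_trans _ _ (slots q t.+1 (prot_strat q m) m + e)); last by rewrite lerD2r slots_le_lat.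
rewrite slotsS -addrA lerD2l -[X in _ <= _ + X](is_dist_avg_cst e (vq hm)) -big_split /=.
apply: ler_sum => a _; rewrite -mulrDr; apply: ler_wpM2l; first by case: (vq hm).
apply: (@le_trans _ _ (cont (q m) m a (fun m' => slots q t (prot_strat q m') m' + e * 1))).
  apply: cont_le => //; first exact: vq.
  move=> m' /andP[m'0 m'm]; have := ht m'; rewrite m'0 (leq_trans m'm mn) => /(_ isT); lra.
by rewrite contD contZ lerD2l ler_piMr ?(ltW e0) // cont1_le //; exact: vq.
Qed.

(** No term of the average over actions is below [lat m] and the average does not exceed it, so
    every term of positive weight equals it. *)
Lemma lat_support m a : (1 <= m <= n)%N -> 0 < q m a -> lat m = 1 + cont (q m) m a lat.
Proof.
move=> hm qa; have [d0 d1] := vq hm; apply: le_anti; rewrite lat_le_cont //= leNgt; apply/negP => h.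
have := cont_le_lat hm; rewrite leNgt => /negP; apply.
rewrite -(is_dist_avg_cst (lat m) (vq hm)) -[X in _ < X + _](is_dist_avg_cst 1 (vq hm)) -big_split /=.
rewrite (bigD1 a) //= [ltRHS](bigD1 a) //=; apply: ltr_leD.
  by rewrite -mulrDr ltr_pM2l.
by apply: ler_sum => b _; rewrite -mulrDr ler_wpM2l // lat_le_cont.
Qed.

Lemma lat_ge1 m : (1 <= m <= n)%N -> 1 <= lat m.
Proof. by move=> hm; have := slots_le_lat 1 hm; rewrite /slots big_ord_recl big_ord0 addr0. Qed.

Lemma lat1 : (1 <= n)%N -> lat 1 = 1.
Proof.
move=> n1; have h1 : (1 <= 1 <= n)%N by [].
apply: le_anti; rewrite lat_ge1 // andbT.
have := lat_le_cont ch1 h1; rewrite (@cont_channel R (q 1) 1 lat ch1 ch2 (vq h1) (or_introl erefl)) /gain1 /=.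
by rewrite expr0; lra.
Qed.

Lemma lat_stage m : (2 <= m <= n)%N ->
  stage m.-1 (lat m.-1) (lat m.-1 - lat m.-2) (lat m) (q m ch1) (q m ch2).
Proof.
move=> /andP[m2 mn]; have hm : (1 <= m <= n)%N by rewrite (ltnW m2).
have [d0 _] := vq hm; have dE := dist2 (vq hm).
have c0 := @cont0 R (q m) m lat (vq hm).
have c1 := @cont_channel R (q m) m lat ch1 ch2 (vq hm) (or_introl erefl).
have c2 := @cont_channel R (q m) m lat ch2 ch1 (vq hm) (or_intror erefl).
split => //.
- by have := lat_ge1 hm; lra.
- by have := d0 ord0; lra.
- by have := lat_le_cont ord0 hm; lra.
- by move=> xy; have := @lat_support m ord0 hm; rewrite dE c0 => /(_ ltac:(lra)); lra.
- by have := lat_le_cont ch1 hm; lra.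
- by move=> x0; have := lat_support hm x0; lra.
- by have := lat_le_cont ch2 hm; lra.
- by move=> x0; have := lat_support hm x0; lra.
Qed.

Lemma lat_eqlat m : (2 <= m <= n)%N ->
  [/\ lat m = eqlat R m, lat m.-1 = eqlat R m.-1,
      q m ch1 = eqprob R m & q m ch2 = eqprob R m].
Proof.
case: m => // -[//|m]; elim: m => [|m IH] hm.
  have S := lat_stage hm; have e1 : lat 1 = 1 by apply: lat1; case/andP: hm => _ /ltnW.
  (* [E] involves the meaningless value [lat 0], but [stage1] holds for every [E]. *)
  simpl in S; rewrite e1 in S; have [V2 x2 y2] := stage1 S.
  have [_ S'] := admissible_eqlat R 0; have [V2' x2' _] := stage1 S'.
  by rewrite V2 x2 y2 V2' x2'.
have hm' : (2 <= m.+2 <= n)%N by case/andP: hm => _ /ltnW.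
have [l1 l0 _ _] := IH hm'; have S := lat_stage hm; rewrite /= in l0 S *.
have [A S'] := admissible_eqlat R m.+1.
rewrite l1 l0 in S; have [-> e2 e3 e4] := stage_unique A S S'.
by rewrite e3 e2.
Qed.

End Necessity.

(** * The equilibrium protocol *)

Section Existence.
Variable R : realType.

Lemma action2P (P : action 2 -> Prop) : P ord0 -> P ch1 -> P ch2 -> forall a, P a.
Proof.
move=> p0 p1 p2 [[|[|[|//]]] i].
- by rewrite (_ : Ordinal i = ord0) //; exact: val_inj.
- by rewrite (_ : Ordinal i = ch1) //; exact: val_inj.
- by rewrite (_ : Ordinal i = ch2) //; exact: val_inj.
Qed.

Definition eqprot : protocol R 2 := fun m a =>
  if (m <= 1)%N then (a == ch1)%:R
  else if a == ord0 then 1 - 2 * eqprob R m else eqprob R m.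

Lemma eqprotE m : (2 <= m)%N ->
  [/\ eqprot m ord0 = 1 - 2 * eqprob R m, eqprot m ch1 = eqprob R m & eqprot m ch2 = eqprob R m].
Proof. by move=> m2; rewrite /eqprot leqNgt m2. Qed.

Lemma eqprot_valid n : valid_protocol n eqprot.
Proof.
move=> m /andP[m1 _]; have [m2|] := leqP 2 m; last first.
  by case: m m1 => [|[|//]] // _ _; exact: is_dist_delta.
case: m m2 {m1} => [|[|m]] // m2; have [e0 e1 e2] := eqprotE m2.
have [_ S] := admissible_eqlat R m; have := stage_x S; have := stage_xy S => s1 s2.
split; first by apply: action2P; rewrite ?e0 ?e1 ?e2; lra.
by rewrite sum_action2 e0 e1 e2; ring.
Qed.

Lemma eqlat_ge0 m : 0 <= eqlat R m.
Proof.
case: m => [|[|m]]; rewrite ?ler01 //.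
by have [_ S] := admissible_eqlat R m; have := stage_gt0 S; lra.
Qed.

Lemma eqprot_cont m (vm : is_dist (eqprot m)) : (1 <= m)%N ->
  (forall a, eqlat R m <= 1 + cont (eqprot m) m a (eqlat R)) /\
  1 + \sum_a eqprot m a * cont (eqprot m) m a (eqlat R) <= eqlat R m.
Proof.
move=> m1.
have c0 := @cont0 R (eqprot m) m (eqlat R) vm.
have c1 := @cont_channel R (eqprot m) m (eqlat R) ch1 ch2 vm (or_introl erefl).
have c2 := @cont_channel R (eqprot m) m (eqlat R) ch2 ch1 vm (or_intror erefl).
rewrite sum_action2; case: m m1 vm c0 c1 c2 => [//|[_ vm|m _ vm]].
  have v0 : eqprot 1 ord0 = 0 by [].
  have v1 : eqprot 1 ch1 = 1 by [].
  have v2 : eqprot 1 ch2 = 0 by [].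
  move: (eqprot 1) v0 v1 v2 {vm} => d v0 v1 v2.
  rewrite /gain0 /gain1 /= !expr0 !(mul0r, mul1r) v0 v1 v2 => c0 c1 c2.
  by split; first apply: action2P; rewrite ?c0 ?c1 ?c2; lra.
have [e0 e1 e2] := @eqprotE m.+2 isT; rewrite e0 e1 e2.
have [_ S] := admissible_eqlat R m; move: (eqprob R m.+2) S => p S.
set V := eqlat R m.+2; rewrite [m.+2.-1]/= [m.+2.-2]/= -/V in S *.
case: S => V0 p0 _ pp g0 g0e g1 g1e _ _ c0 c1 c2; split.
  by apply: action2P; rewrite ?c0 ?c1 ?c2; lra.
rewrite c0 c1 c2.
set G0 := gain0 _ _ _ _ _ in g0 g0e *; set G1 := gain1 _ _ _ _ _ in g1 g1e *.
(* Complementary slackness: each action has probability zero or gain one, so the average of the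
   continuations is exact. *)
have h0 : (1 - 2 * p) * (1 - G0) = 0.
  have [/g0e ->|pp'] := ltrP (p + p) 1; first by rewrite subrr mulr0.
  by have -> : 1 - 2 * p = 0 by [lra]; rewrite mul0r.
have h1 : p * (1 - G1) = 0.
  move: p0; rewrite le_eqVlt => /orP[/eqP <-|/g1e ->]; rewrite ?mul0r //.
  by rewrite subrr mulr0.
lra.
Qed.

Lemma eqprot_equilibrium n : equilibrium n eqprot.
Proof.
move=> m hm s vs; have vq := @eqprot_valid n.
apply: (@le_trans _ _ (eqlat R m)%:E).
  apply: (@prot_latency_le R 2 n) => // [m' _|m' hm']; first exact: eqlat_ge0.
  by have /andP[m1 _] := hm'; have [] := eqprot_cont (vq _ hm') m1.
apply: (@value_le_latency R 2 n) => // m' a hm'.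
by have /andP[m1 _] := hm'; have [] := eqprot_cont (vq _ hm') m1.
Qed.

End Existence.

Theorem theorem6 (R : realType) :
  exists p : nat -> R,
    (* existence, for every number n of players, of an equilibrium of the form *)
    (forall n : nat, exists q : protocol R 2,
        valid_protocol n q /\ equilibrium n q /\
        (forall m, (2 <= m <= n)%N -> q m ch1 = p m /\ q m ch2 = p m)) /\
    (* uniqueness: every anonymous history-independent equilibrium has this form *)
    (forall (n : nat) (q : protocol R 2), valid_protocol n q -> equilibrium n q ->
        forall m, (2 <= m <= n)%N -> q m ch1 = p m /\ q m ch2 = p m) /\
    (* p_m = Theta(1 / sqrt m) *)
    (exists (c1 c2 : R) (M0 : nat), 0 < c1 /\ 0 < c2 /\
        forall m : nat, (M0 <= m)%N ->
          c1 / Num.sqrt (m%:R) <= p m /\ p m <= c2 / Num.sqrt (m%:R)) /\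
    (* expected future latency e^{Theta(sqrt m)} *)
    (exists (c3 c4 : R) (M0 : nat), 0 < c3 /\ 0 < c4 /\
        forall (n : nat) (q : protocol R 2), valid_protocol n q -> equilibrium n q ->
          forall m : nat, (M0 <= m <= n)%N ->
            ((expR (c3 * Num.sqrt (m%:R)))%:E <= latency q (prot_strat q m) m)%E /\
            (latency q (prot_strat q m) m <= (expR (c4 * Num.sqrt (m%:R)))%:E)%E).
Proof.
exists (eqprob R); split; [|split; [|split]].
- move=> n; exists (@eqprot R); split; first exact: eqprot_valid.
  split; first exact: eqprot_equilibrium.
  by move=> m /andP[m2 _]; have [] := eqprotE R m2.
- by move=> n q vq eqq m hm; have [] := lat_eqlat vq eqq hm.
- exists (1 / 8), 64, 5%N; split; [lra | split; [lra | exact: eqprob_bounds]].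
exists (1 / 4), 4, 4%N; split; [lra | split; [lra |]].
move=> n q vq eqq m /andP[m4 mn].
have m2 : (2 <= m)%N by apply: leq_trans m4.
rewrite (latE vq eqq) ?(ltnW m2) //.
have hm : (2 <= m <= n)%N by rewrite m2.
have [-> _ _ _] := lat_eqlat vq eqq hm.
by rewrite !lee_fin; apply/andP; exact: eqlat_exp_bounds.
Qed.
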